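(* Let $a$ be a fixed positive integer. Then for every $N\in\mathbb N$ with $N\ge 2$, $$\sum_{\substack{n\le N\\ (n,a)=1}}\Bigg|R(n;a)-\frac1{\phi(a)}\sum_{\substack{\chi \bmod a\\ \chi^2=\chi_0}}\bar\chi(-n)\sum_{u\mid n^2}\chi(u)\Bigg|^2\ll_a N\log^2 N,$$ where the implicit constant depends at most on $a$.
   Context: For positive integers $n,a$, $R(n;a)$ denotes the number of ordered pairs $(x,y)$ of positive integers with $\frac an=\frac1x+\frac1y$. The outer sum is over positive integers $n\le N$ coprime to $a$. $\phi$ is Euler's totient function. The sum over $\chi$ runs over all Dirichlet characters $\chi$ modulo $a$ with $\chi^2=\chi_0$, where $\chi_0$ is the principal character modulo $a$ (so $\chi=\chi_0$ itself is included). The sum over $u$ is over positive divisors $u$ of $n^2$. *)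

(* Defs.v *)
(* MathComp-Analysis; complex numbers are [R[i]] over [R : realType]. *)
From HB Require Import structures.
From mathcomp Require Export all_boot all_order all_algebra.
From mathcomp Require Export all_classical all_reals all_analysis.
From mathcomp Require Export finmap complex.

Set Implicit Arguments.
Unset Strict Implicit.
Unset Printing Implicit Defensive.

Import GRing.Theory Num.Theory.
Local Open Scope fset_scope.
Local Open Scope classical_set_scope.
Local Open Scope ring_scope.

Definition egyptian_pairs (n a : nat) : set (nat * nat) :=
  [set p | [/\ (0 < p.1)%N, (0 < p.2)%N &
             a%:R / n%:R = p.1%:R^-1 + p.2%:R^-1 :> rat]].

(* For positive n and a the set of pairs is finite, each entry of a solution
   being at most 2 n ^ 2; [fset_set] sends an infinite set to the empty one. *)
Definition nb_egyptian (n a : nat) : nat := #|` fset_set (egyptian_pairs n a)|.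

(* Multiplicativity at 1 together with the third clause forces chi 1 = 1. *)
Definition dirichlet_character (R : realType) (a : nat) (chi : int -> R[i]) :
    Prop :=
  [/\ forall m n : int, chi (m * n) = chi m * chi n,
      forall m : int, chi (m + a%:Z) = chi m &
      forall m : int, (chi m != 0) = coprimez m a].

Definition principal_character (R : realType) (a : nat) : int -> R[i] :=
  fun m => (coprimez m a)%:R.
Arguments principal_character : clear implicits.

(* For a > 0 this set is finite (chi is a-periodic with values in {0, 1, -1}),
   so [\sum_(chi \in _)], which is 0 for infinite support, is the usual sum. *)
Definition square_principal_characters (R : realType) (a : nat) :
    set (int -> R[i]) :=
  [set chi | dirichlet_character a chi /\
             (fun m => chi m ^+ 2) = principal_character R a].
Arguments square_principal_characters : clear implicits.

Definition quadratic_main_term (R : realType) (n a : nat) : R[i] :=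
  (totient a)%:R^-1 *
  \sum_(chi \in square_principal_characters R a)
    ((chi (- n%:Z))^*%R * \sum_(u <- divisors (n ^ 2)) chi u%:Z).
Arguments quadratic_main_term : clear implicits.

(* Main.v *)
Require Import Defs.
From mathcomp Require Import all_fingroup all_solvable all_field all_character.
From mathcomp Require Import ring lra zify.

(** For [n] coprime to [a], clearing denominators turns [a/n = 1/x + 1/y] into
    [(a x - n)(a y - n) = n^2], so [R(n;a)] counts the divisors [u] of [n^2] with
    [u = -n] modulo [a]. Orthogonality of characters shows that the difference to
    be bounded is the part of the character expansion with [chi^2 <> chi_0], and it
    remains to bound the second moment of [f(n) = sum_(u | n^2) chi(u)] for such a
    [chi].

    At a prime [p], [|f(p)|^2 = |1 + chi(p) + chi(p)^2|^2] is a sum of nine terms,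
    which are the values at [p] of [1] (three times), of [chi] and its conjugate
    (twice each), and of [chi^2] and its conjugate. Let [A] be the Dirichlet
    convolution of these nine functions. It is nonnegative, because its logarithmic
    derivatives are, and writing [n = s b^2 c^3] with the exactly dividing primes in
    [s] gives [|f(n)|^2 <= K sqrt(b) c A(s)]. This reduces everything to
    [sum_(n <= x) A(n) << x log^2 x]. The six nonprincipal characters convolve to a
    function whose partial sums are [O(x^alpha)] with [alpha < 1], by the hyperbola
    method. Convolving with [1] a first time gives partial sums [O(x)], as
    [sum_(k <= x) (x/k)^alpha = O(x)], and each of the two remaining convolutions
    costs one factor [log x]. *)

Import Order.TTheory GRing.Theory Num.Theory.
Local Open Scope ring_scope.
Local Open Scope complex_scope.

Set Implicit Arguments.
Unset Strict Implicit.
Unset Printing Implicit Defensive.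

(** * Dirichlet convolution *)

(** The range on the right does not depend on [n], so a sum over [n] up to [x] can be exchanged with
    the sum over divisors. *)
Lemma big_divisors_dvd (V : nmodType) (n x : nat) (F : nat -> V) :
  (0 < n <= x)%N ->
  \sum_(d <- divisors n) F d = \sum_(1 <= d < x.+1 | (d %| n)%N) F d.
Proof.
case/andP=> n_gt0 le_nx; rewrite -[RHS]big_filter; apply: perm_big.
apply: uniq_perm; rewrite ?divisors_uniq ?filter_uniq ?iota_uniq // => d.
rewrite mem_filter mem_index_iota -dvdn_divisors //.
case dvd: (d %| n)%N => //=.
by rewrite (dvdn_gt0 n_gt0 dvd) ltnS (leq_trans (dvdn_leq n_gt0 dvd)).
Qed.

Lemma quotient_gt0 (n d : nat) : (0 < n)%N -> (d %| n)%N -> (0 < n %/ d)%N.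
Proof. by move=> n_gt0 dvd; rewrite divn_gt0 ?(dvdn_gt0 n_gt0 dvd) // dvdn_leq. Qed.

Lemma big_divisors_mul (V : nmodType) (n e : nat) (F : nat -> V) :
  (0 < n)%N -> (e %| n)%N ->
  \sum_(d <- divisors n | (e %| d)%N) F d = \sum_(f <- divisors (n %/ e)) F (e * f)%N.
Proof.
move=> n_gt0 dvd_en; have e_gt0 := dvdn_gt0 n_gt0 dvd_en.
have q_gt0 := quotient_gt0 n_gt0 dvd_en.
rewrite -[RHS](big_map (muln e) predT) -[LHS]big_filter; apply: perm_big.
apply: uniq_perm; rewrite ?filter_uniq ?divisors_uniq //.
  rewrite map_inj_uniq ?divisors_uniq // => i j /eqP.
  by rewrite eqn_pmul2l // => /eqP.
move=> d; rewrite mem_filter -dvdn_divisors //; apply/andP/mapP.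
  case=> /dvdnP[f ->] dvd; exists f; last by rewrite mulnC.
  by rewrite -dvdn_divisors // dvdn_divRL // .
case=> f; rewrite -dvdn_divisors // dvdn_divRL // => dvd ->.
by rewrite dvdn_mulr // mulnC.
Qed.

Lemma big_multiples (V : nmodType) (x m : nat) (F : nat -> V) :
  (0 < m)%N ->
  \sum_(1 <= n < x.+1 | (m %| n)%N) F n = \sum_(1 <= k < (x %/ m).+1) F (m * k)%N.
Proof.
move=> m_gt0; rewrite -[RHS](big_map (muln m) predT) -[LHS]big_filter; apply: perm_big.
apply: uniq_perm; rewrite ?filter_uniq ?iota_uniq //.
  rewrite map_inj_uniq ?iota_uniq // => i j /eqP.
  by rewrite eqn_pmul2l // => /eqP.
move=> d; rewrite mem_filter mem_index_iota; apply/and3P/mapP.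
  case=> /dvdnP[f ->]; rewrite muln_gt0 ltnS => /andP[f_gt0 _] le; exists f.
    by rewrite mem_index_iota f_gt0 ltnS leq_divRL.
  by rewrite mulnC.
case=> f; rewrite mem_index_iota ltnS leq_divRL // => /andP[f_gt0 le] ->.
by rewrite dvdn_mulr // muln_gt0 m_gt0 f_gt0 ltnS mulnC.
Qed.

(* Not a sum over [divisors n], which would give a nonzero value at 0 since
   [divisors 0 = [:: 1]]. *)
Definition dirichlet_conv (R : pzSemiRingType) (A B : nat -> R) : nat -> R :=
  fun n => \sum_(1 <= d < n.+1 | (d %| n)%N) A d * B (n %/ d)%N.

Lemma dirichlet_conv0 (R : pzSemiRingType) (A B : nat -> R) : dirichlet_conv A B 0 = 0.
Proof. by rewrite /dirichlet_conv big_nat_cond big_pred0 // => -[]. Qed.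

Lemma dirichlet_convE (R : pzSemiRingType) (A B : nat -> R) (n : nat) : (0 < n)%N ->
  dirichlet_conv A B n = \sum_(d <- divisors n) A d * B (n %/ d)%N.
Proof. by move=> n_gt0; rewrite (@big_divisors_dvd _ n n) // n_gt0 leqnn. Qed.

Lemma divisors_sym (n : nat) : (0 < n)%N -> perm_eq (divisors n) [seq (n %/ d)%N | d <- divisors n].
Proof.
case: n => [//|n] _; apply: uniq_perm; rewrite ?divisors_uniq //.
  rewrite map_inj_in_uniq ?divisors_uniq //.
  apply: (can_in_inj (g := divn n.+1)) => d; rewrite -dvdn_divisors // => dvd.
  by rewrite divnA // mulKn.
move=> d; rewrite -dvdn_divisors //; apply/idP/mapP.
  move=> dvd; exists (n.+1 %/ d)%N; last by rewrite divnA // mulKn.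
  by rewrite -dvdn_divisors // dvdn_div.
by case=> e; rewrite -dvdn_divisors // => dvd ->; rewrite dvdn_div.
Qed.

Lemma dirichlet_convC (R : comPzSemiRingType) (A B : nat -> R) :
  dirichlet_conv A B = dirichlet_conv B A.
Proof.
apply/funext=> -[|n]; first by rewrite !dirichlet_conv0.
rewrite !dirichlet_convE // (perm_big _ (divisors_sym _)) // big_map.
apply: eq_big_seq => d; rewrite -dvdn_divisors // => dvd.
by rewrite mulrC divnA // mulKn.
Qed.

Lemma dirichlet_convA (R : pzSemiRingType) (A B C : nat -> R) :
  dirichlet_conv A (dirichlet_conv B C) = dirichlet_conv (dirichlet_conv A B) C.
Proof.
apply/funext=> -[|n]; first by rewrite !dirichlet_conv0.
set N := n.+1; rewrite !dirichlet_convE //.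
(* Both sides become the sum over chains [e %| d %| N], with [d = e * f] on the left. *)
transitivity (\sum_(d <- divisors N) \sum_(e <- divisors N | (e %| d)%N)
    A e * B (d %/ e)%N * C (N %/ d)%N); last first.
  apply: eq_big_seq => d; rewrite -dvdn_divisors // => dvd.
  have d_gt0 : (0 < d)%N by exact: dvdn_gt0 dvd.
  rewrite dirichlet_convE // big_distrl /= -[LHS]big_filter; apply: perm_big; apply: uniq_perm.
  - by rewrite filter_uniq ?divisors_uniq.
  - exact: divisors_uniq.
  move=> e; rewrite mem_filter -!dvdn_divisors //.
  by case dvd' : (e %| d)%N => //=; rewrite (dvdn_trans dvd').
rewrite (exchange_big_dep predT) //=.
apply: eq_big_seq => e; rewrite -dvdn_divisors // => dvd.
have e_gt0 : (0 < e)%N by exact: dvdn_gt0 dvd.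
rewrite big_divisors_mul // dirichlet_convE ?quotient_gt0 //.
rewrite big_distrr /=; apply: eq_big_seq => f _.
by rewrite mulKn // divnMA mulrA.
Qed.

Lemma dirichlet_convDl (R : pzSemiRingType) (A B C : nat -> R) :
  dirichlet_conv (fun n => A n + B n) C =
  fun n => dirichlet_conv A C n + dirichlet_conv B C n.
Proof.
by apply/funext=> n; rewrite /dirichlet_conv -big_split; apply: eq_bigr => d _; rewrite mulrDl.
Qed.

Lemma sum_dirichlet_conv (R : pzSemiRingType) (A B : nat -> R) (x : nat) :
  \sum_(1 <= n < x.+1) dirichlet_conv A B n =
  \sum_(1 <= m < x.+1) A m * \sum_(1 <= k < (x %/ m).+1) B k.
Proof.
under eq_big_nat => n /andP[n_gt0 lt_nx].
  rewrite dirichlet_convE // (@big_divisors_dvd _ n x) ?n_gt0 //.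
  over.
rewrite (exchange_big_dep predT) //=; apply: eq_big_nat => m /andP[m_gt0 _].
rewrite big_multiples // big_distrr; apply: eq_big_nat => k _.
by rewrite mulKn.
Qed.

(** The Leibniz rule: [logn p] is additive over each factorisation of [n] into [d] and [n %/ d]. *)
Lemma dirichlet_conv_log (R : comPzRingType) (p : nat) (A B : nat -> R) (n : nat) :
  (logn p n)%:R * dirichlet_conv A B n =
  dirichlet_conv (fun m => (logn p m)%:R * A m) B n +
  dirichlet_conv A (fun m => (logn p m)%:R * B m) n.
Proof.
case: n => [|n]; first by rewrite !dirichlet_conv0 mulr0 addr0.
rewrite !dirichlet_convE // -big_split big_distrr /=; apply: eq_big_seq => d.
rewrite -dvdn_divisors // => dvd; have d_gt0 : (0 < d)%N by exact: dvdn_gt0 dvd.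
have -> : logn p n.+1 = (logn p d + logn p (n.+1 %/ d))%N.
  by rewrite -lognM ?quotient_gt0 // mulnC divnK.
by rewrite natrD mulrDl [A d * (_ * _)]mulrCA mulrA.
Qed.

(** The part at [p] of [g] times the von Mangoldt function, with the factor log p removed. The test
    [p %| m] excludes the exponent 0. *)
Definition on_prime_powers (R : pzSemiRingType) (p : nat) (g : nat -> R) : nat -> R :=
  fun m => if (p %| m)%N && (m == p ^ logn p m)%N then g m else 0.

Lemma big_on_prime_powers (R : pzSemiRingType) (p n : nat) (g : nat -> R) (F : nat -> R) :
  prime p -> (0 < n)%N ->
  \sum_(d <- divisors n) on_prime_powers p g d * F d =
  \sum_(1 <= j < (logn p n).+1) g (p ^ j)%N * F (p ^ j)%N.
Proof.
move=> p_pr n_gt0; rewrite -[RHS](big_map (expn p) predT (fun d => g d * F d)).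
rewrite (bigID [pred d | (p %| d)%N && (d == p ^ logn p d)%N]) /=.
rewrite [X in _ + X]big1 => [|d /negPf nd]; last by rewrite /on_prime_powers nd mul0r.
rewrite addr0 -big_filter.
transitivity (\sum_(d <- [seq d <- divisors n | (p %| d)%N && (d == p ^ logn p d)%N]) g d * F d).
  by apply: eq_big_seq => d; rewrite mem_filter /on_prime_powers => /andP[->].
apply: perm_big; apply: uniq_perm; rewrite ?filter_uniq ?divisors_uniq //.
  rewrite map_inj_uniq ?iota_uniq // => i j; exact/expnI/prime_gt1.
move=> d; rewrite mem_filter -dvdn_divisors //; apply/andP/mapP.
  case=> /andP[dvd_p /eqP eq_d] dvd; exists (logn p d) => //.
  rewrite mem_index_iota ltnS dvdn_leq_log // logn_gt0 mem_primes p_pr dvd_p.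
  by rewrite (dvdn_gt0 n_gt0 dvd).
case=> j; rewrite mem_index_iota ltnS => /andP[j_gt0 le_j] ->.
by rewrite dvdn_exp // pfactorK // eqxx pfactor_dvdn.
Qed.

(** * Products of completely multiplicative functions *)

Definition completely_multiplicative (R : pzSemiRingType) (g : nat -> R) : Prop :=
  g 1%N = 1 /\ forall m n, g (m * n)%N = g m * g n.

(** Each [p ^ j] dividing [n] with [1 <= j] contributes [g (p ^ j) * g (n %/ p ^ j) = g n], and
    there are [logn p n] of them. *)
Lemma completely_multiplicative_log (R : comPzRingType) (p : nat) (g : nat -> R) (n : nat) :
  prime p -> completely_multiplicative g -> (0 < n)%N ->
  (logn p n)%:R * g n = dirichlet_conv (on_prime_powers p g) g n.
Proof.
move=> p_pr [g1 gM] n_gt0; rewrite dirichlet_convE // big_on_prime_powers //.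
rewrite (eq_big_nat _ _ (F2 := fun=> g n)); last first.
  move=> j /andP[_ le_j]; rewrite -gM mulnC divnK //.
  by rewrite pfactor_dvdn.
by rewrite big_const_nat iter_addr_0 subn1 /= mulr_natl.
Qed.

Definition dirichlet_unit (R : pzSemiRingType) : nat -> R := fun n => (n == 1%N)%:R.

Definition dirichlet_prod (R : pzSemiRingType) (s : seq (nat -> R)) : nat -> R :=
  foldr (@dirichlet_conv R) (@dirichlet_unit R) s.

(* Multiplication by [logn p] is a derivation for Dirichlet convolution, and a
   completely multiplicative function has logarithmic derivative
   [on_prime_powers p g]; logarithmic derivatives of products add up. *)
Lemma dirichlet_prod_log (R : comPzRingType) (p : nat) (s : seq (nat -> R)) (n : nat) :
  prime p -> (forall i, (i < size s)%N -> completely_multiplicative (nth (fun=> 0) s i)) ->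
  (0 < n)%N ->
  (logn p n)%:R * dirichlet_prod s n =
  dirichlet_conv (on_prime_powers p (fun m => \sum_(g <- s) g m)) (dirichlet_prod s) n.
Proof.
move=> p_pr; elim: s n => [|g s IHs] n mul_s n_gt0.
  rewrite dirichlet_convE // big1 => [|d _].
    rewrite /= /dirichlet_unit; case: eqP => [->|_]; last by rewrite mulr0.
    by rewrite logn1 mul0r.
  by rewrite /on_prime_powers big_nil; case: ifP; rewrite mul0r.
have g_mul : completely_multiplicative g by have := mul_s 0%N erefl.
have {}IHs m : (0 < m)%N -> _ := IHs m (fun i => mul_s i.+1).
have -> : on_prime_powers p (fun m => \sum_(f <- g :: s) f m) =
  fun m => on_prime_powers p g m + on_prime_powers p (fun m => \sum_(f <- s) f m) m.
  by apply/funext=> m; rewrite /on_prime_powers; case: ifP; rewrite ?addr0 ?big_cons.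
rewrite /= dirichlet_conv_log dirichlet_convDl; congr (_ + _).
  rewrite dirichlet_convA !dirichlet_convE //; apply: eq_big_seq => d.
  rewrite -dvdn_divisors // => dvd.
  by rewrite completely_multiplicative_log //; apply: dvdn_gt0 dvd.
rewrite dirichlet_convA [dirichlet_conv (on_prime_powers _ _) g]dirichlet_convC -dirichlet_convA.
rewrite !dirichlet_convE //; apply: eq_big_seq => d; rewrite -dvdn_divisors // => dvd.
by rewrite IHs ?quotient_gt0.
Qed.

Lemma dirichlet_prod1 (R : comPzRingType) (s : seq (nat -> R)) :
  (forall i, (i < size s)%N -> completely_multiplicative (nth (fun=> 0) s i)) ->
  dirichlet_prod s 1 = 1.
Proof.
elim: s => [|g s IHs] mul_s; first by rewrite /dirichlet_unit.
have [g1 _] : completely_multiplicative g by have := mul_s 0%N erefl.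
rewrite /= dirichlet_convE // big_seq1 divn1 g1 mul1r IHs // => i.
exact: (mul_s i.+1).
Qed.

(** As [p] divides [p * m] exactly once, only the exponent 1 survives in the logarithmic
    derivative. *)
Lemma dirichlet_prod_prime (R : comPzRingType) (p m : nat) (s : seq (nat -> R)) :
  prime p -> (0 < m)%N -> ~~ (p %| m)%N ->
  (forall i, (i < size s)%N -> completely_multiplicative (nth (fun=> 0) s i)) ->
  dirichlet_prod s (p * m) = (\sum_(g <- s) g p) * dirichlet_prod s m.
Proof.
move=> p_pr m_gt0 ndvd mul_s; have p_gt0 := prime_gt0 p_pr.
have pm_gt0 : (0 < p * m)%N by rewrite muln_gt0 p_gt0.
have log1 : logn p (p * m) = 1%N.
  by rewrite lognM // logn_prime // eqxx logn_coprime // prime_coprime.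
have := dirichlet_prod_log p_pr mul_s pm_gt0.
rewrite log1 mul1r => ->; rewrite dirichlet_convE // big_on_prime_powers //.
by rewrite log1 big_nat1 expn1 mulKn.
Qed.

(** Strong induction: for a prime [p] dividing [n], the logarithmic derivative writes a positive
    multiple of the value at [n] as a nonnegative combination of values at the smaller
    [n %/ p ^ j]. *)
Lemma dirichlet_prod_ge0 (R : numDomainType) (s : seq (nat -> R)) (n : nat) :
  (forall i, (i < size s)%N -> completely_multiplicative (nth (fun=> 0) s i)) ->
  (forall p, (0 < p)%N -> 0 <= \sum_(g <- s) g p) ->
  0 <= dirichlet_prod s n.
Proof.
move=> mul_s ge0_s; elim/ltn_ind: n => n IHn.
case: (posnP n) => [->|n_gt0].
  by case: {+}s => [|g l] /=; rewrite ?dirichlet_conv0.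
case: (ltngtP n 1%N) => [||->]; [by case: n n_gt0 {IHn} | move=> n_gt1 |].
  have p_pr := pdiv_prime n_gt1; set p := pdiv n in p_pr *.
  have log_gt0 : (0 < logn p n)%N by rewrite logn_gt0 mem_primes p_pr n_gt0 pdiv_dvd.
  rewrite -(@pmulr_rge0 _ (logn p n)%:R) ?ltr0n // dirichlet_prod_log //.
  rewrite dirichlet_convE // big_on_prime_powers // big_nat.
  apply: sumr_ge0 => j /andP[j_gt0 _]; apply: mulr_ge0.
    by apply: ge0_s; rewrite expn_gt0 prime_gt0.
  by apply: IHn; rewrite ltn_Pdiv // -(exp1n j) ltn_exp2r // prime_gt1.
by rewrite dirichlet_prod1.
Qed.

(** * Sums of real powers *)

(** From [1 + u <= expR u] and [1 <= (1 - u / 2) * (1 + u)] on the unit interval. *)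
Lemma expRN_le (R : realType) (u : R) : 0 <= u <= 1 -> expR (- u) <= 1 - u / 2.
Proof.
move=> /andP[u_ge0 u_le1]; rewrite expRN.
have e_ge : 1 + u <= expR u := expR_ge1Dx u.
have e_gt0 := expR_gt0 u.
rewrite -div1r ler_pdivrMr // (le_trans _ (ler_wpM2l _ e_ge)) //; last by lra.
by nra.
Qed.

(** This is [1 + t <= expR t] at [t = - n.+1%:R^-1]. It replaces integral comparison in the bounds
    for power sums and for harmonic sums. *)
Lemma natr_pred_le_expR (R : realType) (n : nat) :
  n%:R <= n.+1%:R * expR (- n.+1%:R^-1) :> R.
Proof.
have y_gt0 : 0 < n.+1%:R :> R by rewrite ltr0n.
apply: le_trans (ler_wpM2l (ltW y_gt0) (expR_ge1Dx _)).
by rewrite mulrDr mulrN mulfV ?gt_eqF // mulr1 -[n.+1]addn1 natrD addrK.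
Qed.

Lemma powR_subr1 (R : realType) (y d : R) : 0 < y -> y `^ (d - 1) = y `^ d / y.
Proof.
by move=> y_gt0; rewrite powRB ?powRr1 ?ltW //; apply/implyP => _; rewrite gt_eqF.
Qed.

Lemma powR_pred_le (R : realType) (d : R) (n : nat) : 0 <= d ->
  n%:R `^ d <= n.+1%:R `^ d * expR (- (d / n.+1%:R)).
Proof.
move=> d_ge0; have y_ge0 : 0 <= n.+1%:R :> R by rewrite ler0n.
have -> : - (d / n.+1%:R) = - n.+1%:R^-1 * d by rewrite mulNr mulrC.
rewrite expRM -powRM ?expR_ge0 //.
by apply: ge0_ler_powR; rewrite ?nnegrE ?mulr_ge0 ?expR_ge0 // natr_pred_le_expR.
Qed.

Lemma sum_powR_le (R : realType) (d : R) : 0 < d <= 1 -> forall x : nat,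
  \sum_(1 <= k < x.+1) k%:R `^ (d - 1) <= 2 / d * x%:R `^ d.
Proof.
case/andP=> d_gt0 d_le1; elim=> [|x IHx].
  by rewrite big_geq // mulr_ge0 ?powR_ge0 ?divr_ge0 // ltW.
rewrite big_nat_recr //= (le_trans (lerD IHx (lexx _))) //.
have y_gt0 : 0 < x.+1%:R :> R by rewrite ltr0n.
have y_ge1 : 1 <= x.+1%:R :> R by rewrite ler1n.
rewrite addrC -lerBrDr -mulrBr -(ler_pM2l (_ : 0 < d / 2)) ?divr_gt0 // mulrA.
have -> : d / 2 * (2 / d) = 1 by field; rewrite gt_eqF.
rewrite mul1r powR_subr1 //.
rewrite lerBrDl -lerBrDr; apply: le_trans (powR_pred_le _ (ltW d_gt0)) _.
have -> : x.+1%:R `^ d - d / 2 * (x.+1%:R `^ d / x.+1%:R)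
   = x.+1%:R `^ d * (1 - d / x.+1%:R / 2) by field; rewrite gt_eqF.
rewrite ler_wpM2l ?powR_ge0 // expRN_le //; apply/andP; split.
  by rewrite divr_ge0 // ltW.
by rewrite ler_pdivrMr // mul1r (le_trans d_le1).
Qed.

Lemma sum_powR_cvg (R : realType) (d : R) : 0 < d -> forall x : nat,
  \sum_(1 <= k < x.+1) k%:R `^ (- (1 + d)) <= 1 + d^-1.
Proof.
move=> d_gt0; have di_gt0 : 0 < d^-1 by rewrite invr_gt0.
case=> [|x]; first by rewrite big_geq // addr_ge0 // ltW.
(* The subtracted term, a bound for the missing tail, makes the induction telescope. *)
suff : \sum_(1 <= k < x.+2) k%:R `^ (- (1 + d)) <= 1 + d^-1 - d^-1 * x.+1%:R `^ (- d).
  by move/le_trans; apply; rewrite gerBl mulr_ge0 ?powR_ge0 // ltW.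
elim: x => [|x IHx]; first by rewrite big_nat1 powR1 mulr1 addrK.
rewrite big_nat_recr //= (le_trans (lerD IHx (lexx _))) //.
set y := x.+2%:R; have y_gt0 : 0 < y by rewrite ltr0n.
have x_gt0 : 0 < x.+1%:R :> R by rewrite ltr0n.
suff : y `^ (- d) / y <= d^-1 * x.+1%:R `^ (- d) - d^-1 * y `^ (- d).
  have -> : - (1 + d) = - d - 1 by rewrite opprD addrC.
  rewrite powR_subr1 // => le_y; rewrite -addrA lerD2l addrC -lerBrDr.
  by rewrite opprK addrC.
rewrite -mulrBr -(ler_pM2l d_gt0) mulrA mulrA mulfV ?gt_eqF // mul1r.
rewrite lerBrDl [x.+1%:R `^ _]powRN.
have := powR_pred_le x.+1 (ltW d_gt0); rewrite -/y => le_x.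
have xd_gt0 : 0 < x.+1%:R `^ d by apply: powR_gt0.
have yd_gt0 : 0 < y `^ d by apply: powR_gt0.
apply: le_trans (_ : (y `^ d * expR (- (d / y)))^-1 <= _); last first.
  by rewrite lef_pV2 ?posrE ?mulr_gt0 ?expR_gt0.
rewrite invfM -expRN opprK -powRN.
have -> : y `^ (- d) + d * y `^ (- d) / y = y `^ (- d) * (1 + d / y).
  by field; rewrite gt_eqF.
by rewrite ler_wpM2l ?powR_ge0 // expR_ge1Dx.
Qed.

(** * Partial sums of Dirichlet convolutions *)

(** The norm on [R[i]] takes its values in [R[i]]; this version is real, so that it can be compared
    with real powers. *)
Definition modulus (R : realType) (z : R[i]) : R := complex.Re `|z|.

Lemma modulusE (R : realType) (z : R[i]) : (modulus z)%:C = `|z|.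
Proof. by rewrite /modulus normc_def. Qed.

Lemma modulus_ge0 (R : realType) (z : R[i]) : 0 <= modulus z.
Proof. by rewrite -ler0c modulusE. Qed.

Lemma modulus0 (R : realType) : modulus (0 : R[i]) = 0.
Proof. by apply: complexI; rewrite modulusE normr0. Qed.

Lemma modulus1 (R : realType) : modulus (1 : R[i]) = 1.
Proof. by apply: complexI; rewrite modulusE normr1. Qed.

Lemma modulusN (R : realType) (z : R[i]) : modulus (- z) = modulus z.
Proof. by rewrite /modulus normrN. Qed.

Lemma modulusM (R : realType) (z w : R[i]) : modulus (z * w) = modulus z * modulus w.
Proof. by apply: complexI; rewrite rmorphM /= !modulusE normrM. Qed.

Lemma ler_modulusD (R : realType) (z w : R[i]) : modulus (z + w) <= modulus z + modulus w.
Proof. by rewrite -lecR rmorphD /= !modulusE ler_normD. Qed.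

Lemma ler_modulus_sum (R : realType) (I : Type) (r : seq I) (P : pred I) (F : I -> R[i]) :
  modulus (\sum_(i <- r | P i) F i) <= \sum_(i <- r | P i) modulus (F i).
Proof.
elim/big_ind2: _ => [|x1 x2 y1 y2 le1 le2|//]; first by rewrite modulus0.
by rewrite (le_trans (ler_modulusD _ _)) ?lerD.
Qed.

Lemma ler_natr_div (R : realFieldType) (x m : nat) : (0 < m)%N ->
  (x %/ m)%:R <= x%:R / m%:R :> R.
Proof.
by move=> m_gt0; rewrite ler_pdivlMr ?ltr0n // -natrM ler_nat leq_divM.
Qed.

Lemma powR_div_le (R : realType) (x m : nat) (b : R) : 0 <= b -> (0 < m)%N ->
  (x %/ m)%:R `^ b <= x%:R `^ b * m%:R `^ (- b).
Proof.
move=> b_ge0 m_gt0; have m_ge0 : 0 <= m%:R :> R by rewrite ler0n.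
have -> : m%:R `^ (- b) = m%:R^-1 `^ b.
  by rewrite -[m%:R^-1]powR_inv1 // -powRrM mulN1r.
rewrite -powRM ?invr_ge0 //; apply: ge0_ler_powR; rewrite ?nnegrE ?ler0n ?mulr_ge0 ?invr_ge0 //.
exact: ler_natr_div.
Qed.

Lemma sum_modulus_dirichlet_prod (R : realType) (b : R) (s : seq (nat -> R[i])) :
  1 < b -> (forall i n, (i < size s)%N -> modulus (nth (fun=> 0) s i n) <= 1) ->
  exists2 D : R, 0 <= D & forall x : nat,
    \sum_(1 <= n < x.+1) modulus (dirichlet_prod s n) <= D * x%:R `^ b.
Proof.
move=> b_gt1; have b_gt0 : 0 < b by apply: lt_trans b_gt1.
elim: s => [|g s IHs] le1.
  exists 1 => // -[|x]; first by rewrite big_geq // powR0 ?mulr0 ?gt_eqF.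
  rewrite mul1r big_ltn // big_nat big1 => [|i /andP[lt1i _]]; last first.
    by rewrite /= /dirichlet_unit gtn_eqF // modulus0.
  rewrite addr0 /= /dirichlet_unit modulus1.
  have x_ge1 : 1 <= x.+1%:R :> R by rewrite ler1n.
  by have := ler_powR x_ge1 (ltW b_gt0); rewrite powRr0.
have [D D_ge0 le_D] := IHs (fun i n => le1 i.+1 n).
pose Z := 1 + (b - 1)^-1; have Z_ge0 : 0 <= Z by rewrite addr_ge0 // invr_ge0 subr_ge0 ltW.
exists (D * Z); first exact: mulr_ge0.
move=> x; pose absg n := modulus (g n); pose absp n := modulus (dirichlet_prod s n).
have le_conv n : (0 < n)%N -> modulus (dirichlet_prod (g :: s) n) <= dirichlet_conv absg absp n.
  move=> n_gt0; rewrite /= /dirichlet_conv (le_trans (ler_modulus_sum _ _ _)) //.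
  by apply: ler_sum => d _; rewrite modulusM.
apply: le_trans (_ : \sum_(1 <= n < x.+1) dirichlet_conv absg absp n <= _).
  by rewrite !big_nat; apply: ler_sum => n /andP[n_gt0 _]; apply: le_conv.
rewrite sum_dirichlet_conv.
apply: le_trans (_ : \sum_(1 <= m < x.+1) D * x%:R `^ b * m%:R `^ (- b) <= _).
  rewrite !big_nat; apply: ler_sum => m /andP[m_gt0 _].
  apply: le_trans (_ : 1 * \sum_(1 <= k < (x %/ m).+1) absp k <= _).
    rewrite ler_wpM2r //; first by apply: sumr_ge0 => k _; exact: modulus_ge0.
    exact: (le1 0%N m).
  rewrite mul1r (le_trans (le_D _)) // -mulrA ler_wpM2l // powR_div_le //; exact: ltW.
rewrite -big_distrr /= -!mulrA ler_wpM2l // mulrC ler_wpM2r ?powR_ge0 //.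
have := @sum_powR_cvg R (b - 1) _ x; rewrite [1 + (b - 1)]addrC subrK; apply.
by rewrite subr_gt0.
Qed.

Definition summatory (R : pzSemiRingType) (A : nat -> R) (x : nat) : R :=
  \sum_(1 <= n < x.+1) A n.

(** The pairs with [m * k <= x] are split at [m = y]. Those with [y < m] are grouped by [k], which
    is then at most [x %/ y.+1], while [m] runs up to [x %/ k]. *)
Lemma summatory_hyperbola (R : comPzRingType) (A B : nat -> R) (x y : nat) : (y <= x)%N ->
  summatory (dirichlet_conv A B) x =
  \sum_(1 <= m < y.+1) A m * summatory B (x %/ m) +
  \sum_(1 <= k < (x %/ y.+1).+1) B k * (summatory A (x %/ k) - summatory A y).
Proof.
move=> le_yx; rewrite /summatory sum_dirichlet_conv (@big_cat_nat _ _ _ y.+1) //=.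
congr (_ + _).
transitivity (\sum_(y.+1 <= m < x.+1) \sum_(1 <= k < x.+1 | (m * k <= x)%N) A m * B k).
  apply: eq_big_nat => m /andP[lt_ym lt_mx]; have m_gt0 : (0 < m)%N by apply: leq_trans lt_ym.
  rewrite big_distrr /= (@big_nat_widen _ _ _ 1 (x %/ m).+1 x.+1) ?ltnS ?leq_div //.
  by apply: eq_bigl => k; rewrite ltnS leq_divRL //= mulnC.
rewrite (exchange_big_dep predT) //=.
have le_q : ((x %/ y.+1).+1 <= x.+1)%N by rewrite ltnS leq_div.
rewrite [RHS](@big_nat_widen _ _ _ 1 _ x.+1) // big_mkcond [RHS]big_mkcond /=.
apply: eq_big_nat => k /andP[k_gt0 _]; rewrite ltnS leq_divRL // mulnC.
have [le_x|lt_x] := leqP; last first.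
  rewrite big1_seq // => m; rewrite mem_index_iota => /and3P[le_m lt_ym _].
  have : (y.+1 * k <= m * k)%N by rewrite leq_mul2r lt_ym orbT.
  by move/leq_trans/(_ le_m); rewrite leqNgt lt_x.
have le_yk : (y < x %/ k)%N by rewrite leq_divRL.
rewrite (@big_cat_nat _ _ _ y.+1 1 (x %/ k).+1) //=; last exact: leqW.
rewrite addrAC subrr add0r big_distrr /=.
rewrite (@big_nat_widen _ _ _ _ (x %/ k).+1 x.+1) ?ltnS ?leq_div //.
rewrite big_nat_cond [RHS]big_nat_cond; apply: eq_big => m; last by rewrite mulrC.
by rewrite -leq_divRL.
Qed.

Lemma ler_powR_natl (R : realType) (x y : nat) (u : R) :
  0 <= u -> (x <= y)%N -> x%:R `^ u <= y%:R `^ u.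
Proof.
by move=> u_ge0 le_xy; apply: ge0_ler_powR; rewrite ?nnegrE ?ler0n ?ler_nat.
Qed.

(** Hyperbola method. For [m <= y] the bounded sums of [B] leave [M] times the absolute sum of [A];
    for the rest the cancellation in [A] is used in each of the at most [x %/ y.+1] terms. *)
Lemma summatory_conv_bounded (R : realType) (A B : nat -> R[i]) (al C b D M : R) :
  0 <= al < 1 -> 0 <= C -> 1 < b -> 0 <= D -> 0 <= M ->
  (forall x, modulus (summatory A x) <= C * x%:R `^ al) ->
  (forall x : nat, \sum_(1 <= n < x.+1) modulus (A n) <= D * x%:R `^ b) ->
  (forall n, modulus (B n) <= 1) ->
  (forall x, modulus (summatory B x) <= M) ->
  forall x, modulus (summatory (dirichlet_conv A B) x) <=
    (M * D + 2 * C) * x%:R `^ (b * ((1 + al) / 2)).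
Proof.
move=> /andP[al_ge0 al_lt1] C_ge0 b_gt1 D_ge0 M_ge0 S_A T_A B_le1 S_B x.
set g := (1 + al) / 2; have g_gt0 : 0 < g by rewrite divr_gt0 //; lra.
have g_le1 : g <= 1 by rewrite /g; lra.
have bg_gt0 : 0 < b * g by rewrite mulr_gt0 //; lra.
case: x => [|x]; first by rewrite /summatory big_geq // modulus0 mulr_ge0 ?powR_ge0 //; nra.
set N := x.+1; have N_ge1 : 1 <= N%:R :> R by rewrite ler1n.
have N_gt0 : 0 < N%:R :> R by rewrite ltr0n.
pose y := Num.truncn (N%:R `^ g).
have y_le : y%:R <= N%:R `^ g by rewrite truncn_le powR_ge0.
have y_gt : N%:R `^ g < y.+1%:R by exact: truncnS_gt.
have le_yN : (y <= N)%N.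
  by rewrite -(ler_nat R) (le_trans y_le) // ler1_powR.
rewrite (summatory_hyperbola _ _ le_yN) (le_trans (ler_modulusD _ _)) // mulrDl.
apply: lerD.
  apply: le_trans (ler_modulus_sum _ _ _) _.
  apply: le_trans (_ : \sum_(1 <= m < y.+1) M * modulus (A m) <= _).
    by apply: ler_sum => m _; rewrite modulusM mulrC ler_wpM2r ?modulus_ge0.
  rewrite -big_distrr /= -mulrA ler_wpM2l // (le_trans (T_A y)) // ler_wpM2l //.
  rewrite [b * g]mulrC powRrM.
  by apply: ge0_ler_powR; rewrite ?nnegrE ?powR_ge0 ?ler0n // ltW // (lt_trans _ b_gt1).
apply: le_trans (ler_modulus_sum _ _ _) _.
apply: le_trans (_ : \sum_(1 <= k < (N %/ y.+1).+1) (2 * C * N%:R `^ al) <= _).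
  apply: ler_sum => k _; rewrite modulusM.
  apply: le_trans (_ : 1 * (C * N%:R `^ al + C * N%:R `^ al) <= _); last by rewrite mul1r; lra.
  apply: ler_pM; rewrite ?modulus_ge0 // (le_trans (ler_modulusD _ _)) // modulusN.
  by apply: lerD; apply: le_trans (S_A _) _; rewrite ler_wpM2l // ler_powR_natl // leq_div.
rewrite sumr_const_nat subn1 /= -[_ *+ _]mulr_natr -!mulrA ler_wpM2l // ler_wpM2l //.
apply: le_trans (_ : N%:R `^ al * N%:R `^ (1 - g) <= _).
  rewrite ler_wpM2l ?powR_ge0 // (le_trans (ler_natr_div _ _ _)) //.
  rewrite powRB ?powRr1 ?(ltW N_gt0) //; last by apply/implyP => _; rewrite gt_eqF.
  by rewrite ler_wpM2l ?(ltW N_gt0) // lef_pV2 ?posrE ?powR_gt0 // ltW.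
rewrite -powRD; last by apply/implyP => _; rewrite gt_eqF.
by apply: ler_powR => //; rewrite /g; nra.
Qed.

Lemma summatory_dirichlet_prod (R : realType) (s : seq (nat -> R[i])) :
  (0 < size s)%N ->
  (forall i n, (i < size s)%N -> modulus (nth (fun=> 0) s i n) <= 1) ->
  (forall i, (i < size s)%N -> exists M : R, forall x,
     modulus (summatory (nth (fun=> 0) s i) x) <= M) ->
  exists al C : R, [/\ 0 <= al < 1, 0 <= C & forall x,
    modulus (summatory (dirichlet_prod s) x) <= C * x%:R `^ al].
Proof.
elim: s => [//|g s IHs] _ le1 bdd.
have [M le_M] := bdd 0%N isT; rewrite /= in le_M.
have M_ge0 : 0 <= M by rewrite (le_trans _ (le_M 0%N)) // modulus_ge0.
case: s IHs le1 bdd => [|h s] IHs le1 bdd.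
  (* A single factor has bounded partial sums, hence exponent 0. *)
  exists 0, M; split; rewrite ?lexx ?ltr01 // => x; rewrite powRr0 mulr1.
  apply: le_trans (le_M x); rewrite /summatory /= sum_dirichlet_conv.
  rewrite (eq_big_nat _ _ (F2 := g)) // => m /andP[m_gt0 le_mx].
  have q_gt0 : (0 < x %/ m)%N by rewrite divn_gt0.
  rewrite big_ltn // big_nat big1 => [|k /andP[lt1k _]]; last first.
    by rewrite /dirichlet_unit gtn_eqF.
  by rewrite addr0 /dirichlet_unit eqxx mulr1.
have {IHs} := IHs isT (fun i n => le1 i.+1 n) (fun i => bdd i.+1).
case=> al [C [al01 C_ge0 S_s]]; have /andP[al_ge0 al_lt1] := al01.
(* With [g = (1 + al) / 2 < 1], the choice [b = 2 / (1 + g)] gives both [1 < b] and [b * g < 1]. *)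
pose b := 2 / (1 + (1 + al) / 2).
have b_gt1 : 1 < b by rewrite /b ltr_pdivlMr; lra.
have [D D_ge0 T_s] := @sum_modulus_dirichlet_prod R b (h :: s) b_gt1 (fun i n => le1 i.+1 n).
exists (b * ((1 + al) / 2)), (M * D + 2 * C); split.
- apply/andP; split; first by rewrite mulr_ge0 //; lra.
  rewrite /b mulrAC ltr_pdivrMr; lra.
- by rewrite addr_ge0 ?mulr_ge0.
move=> x; rewrite [dirichlet_prod _]/= dirichlet_convC.
apply: (summatory_conv_bounded al01 C_ge0 b_gt1 D_ge0 M_ge0) => //.
by move=> n; exact: (le1 0%N n isT).
Qed.

(** * Harmonic sums and convolution with the constant function 1 *)

Definition harmonic_sum (R : realType) (x : nat) : R := \sum_(1 <= k < x.+1) k%:R^-1.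
Arguments harmonic_sum : clear implicits.

Lemma harmonic_sum_ge0 (R : realType) (x : nat) : 0 <= harmonic_sum R x.
Proof. by apply: sumr_ge0 => k _; rewrite invr_ge0. Qed.

Lemma ler_harmonic_sum (R : realType) (x y : nat) : (x <= y)%N ->
  harmonic_sum R x <= harmonic_sum R y.
Proof.
move=> le_xy; rewrite /harmonic_sum [leRHS](@big_cat_nat _ _ _ x.+1) //= lerDl.
by apply: sumr_ge0 => k _; rewrite invr_ge0.
Qed.

Lemma harmonic_sum_le_ln (R : realType) (x : nat) : (0 < x)%N ->
  harmonic_sum R x <= 1 + ln x%:R.
Proof.
case: x => // x _; elim: x => [|x IHx]; first by rewrite /harmonic_sum big_nat1 ln1 invr1 addr0.
rewrite /harmonic_sum big_nat_recr //= (le_trans (lerD IHx (lexx _))) //.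
have := natr_pred_le_expR R x.+1; rewrite -ler_ln ?posrE ?mulr_gt0 ?expR_gt0 ?ltr0n //.
rewrite lnM ?posrE ?expR_gt0 ?ltr0n // expRK => le_ln.
by rewrite -addrA lerD2l -lerBrDr.
Qed.

Lemma summatory_conv_one (R : realType) (A : nat -> R[i]) (x : nat) :
  modulus (summatory (dirichlet_conv (fun=> 1) A) x) <=
  \sum_(1 <= k < x.+1) modulus (summatory A (x %/ k)).
Proof.
rewrite /summatory sum_dirichlet_conv (le_trans (ler_modulus_sum _ _ _)) //.
by apply: ler_sum => k _; rewrite mul1r.
Qed.

Lemma summatory_conv_one_powR (R : realType) (A : nat -> R[i]) (al C : R) :
  0 <= al < 1 -> 0 <= C ->
  (forall x, modulus (summatory A x) <= C * x%:R `^ al) ->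
  forall x, modulus (summatory (dirichlet_conv (fun=> 1) A) x) <=
    C * (2 / (1 - al)) * x%:R.
Proof.
move=> /andP[al_ge0 al_lt1] C_ge0 S_A x; rewrite (le_trans (summatory_conv_one _ _)) //.
have [->|x_gt0] := posnP x; first by rewrite big_geq // mulr0.
apply: le_trans (_ : \sum_(1 <= k < x.+1) C * x%:R `^ al * k%:R `^ (- al) <= _).
  rewrite !big_nat; apply: ler_sum => k /andP[k_gt0 _].
  by rewrite (le_trans (S_A _)) // -mulrA ler_wpM2l // powR_div_le.
rewrite -big_distrr /= -!mulrA ler_wpM2l // [leRHS]mulrA.
have d01 : 0 < 1 - al <= 1 by lra.
have := sum_powR_le d01 x; rewrite [1 - al - 1]addrAC subrr add0r.
move/(ler_wpM2l (powR_ge0 x%:R al)) => /le_trans; apply.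
rewrite mulrCA -powRD; last by apply/implyP => _; rewrite pnatr_eq0 -lt0n.
by rewrite [al + _]addrC subrK powRr1.
Qed.

Lemma summatory_conv_one_harmonic (R : realType) (A : nat -> R[i]) (j : nat) (C : R) :
  0 <= C ->
  (forall x, modulus (summatory A x) <= C * x%:R * harmonic_sum R x ^+ j) ->
  forall x, modulus (summatory (dirichlet_conv (fun=> 1) A) x) <=
    C * x%:R * harmonic_sum R x ^+ j.+1.
Proof.
move=> C_ge0 S_A x; rewrite (le_trans (summatory_conv_one _ _)) //.
rewrite exprS mulrCA; set K := C * _ * _.
rewrite /harmonic_sum big_distrl /= !big_nat.
apply: ler_sum => k /andP[k_gt0 _]; rewrite (le_trans (S_A _)) // /K mulrA.
apply: ler_pM; rewrite ?mulr_ge0 ?exprn_ge0 ?harmonic_sum_ge0 //.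
  by rewrite mulrCA ler_wpM2l // mulrC ler_natr_div.
apply: lerXn2r; rewrite ?nnegrE ?harmonic_sum_ge0 //.
by rewrite ler_harmonic_sum // leq_div.
Qed.

(** * Dirichlet characters *)

(** As [n] is nonzero in [F], the polynomial ['X^n - 1] is separable and has [n] distinct roots, one
    of which is primitive. *)
Lemma closed_field_prim_root_exists (F : closedFieldType) (n : nat) :
  (0 < n)%N -> n%:R != 0 :> F -> exists z : F, n.-primitive_root z.
Proof.
move=> n_gt0 n_neq0; have [r Dp] := closed_field_poly_normal ('X^n - 1 : {poly F}).
move: Dp; rewrite (monicP _) ?monicXnsubC // scale1r => Dp.
have size_r : size r = n.
  by apply/succn_inj; rewrite -(size_prod_XsubC r id) -Dp size_XnsubC.
have all_r : all n.-unity_root r.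
  by apply/allP=> z; rewrite -topredE /= /root_of_unity Dp root_prod_XsubC.
have uniq_r : uniq r by rewrite -separable_prod_XsubC -Dp separable_Xn_sub_1.
have /hasP[z _ prim_z] := has_prim_root n_gt0 all_r uniq_r (eq_leq (esym size_r)).
by exists z.
Qed.

Lemma dirichlet_character1 (R : realType) (a : nat) (chi : int -> R[i]) :
  dirichlet_character a chi -> chi 1 = 1.
Proof.
case=> chiM _ chi_neq0; have := chi_neq0 1; rewrite /coprimez gcd1z eqxx => chi1_neq0.
by apply: (mulfI chi1_neq0); rewrite -chiM !mulr1.
Qed.

Lemma dirichlet_characterX (R : realType) (a : nat) (chi : int -> R[i]) (m : int) (k : nat) :
  dirichlet_character a chi -> chi (m ^+ k) = chi m ^+ k.
Proof.
move=> chiP; have [chiM _ _] := chiP; elim: k => [|k IHk].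
  by rewrite !expr0 (dirichlet_character1 chiP).
by rewrite !exprS chiM IHk.
Qed.

Lemma dirichlet_character_periodic (R : realType) (a : nat) (chi : int -> R[i]) (m k : int) :
  dirichlet_character a chi -> (a %| m - k)%Z -> chi m = chi k.
Proof.
case=> _ chiD _ /dvdzP[q /(canRL (subrK _)) ->]; rewrite addrC.
elim/int_rect: q => [|n IHn|n IHn]; first by rewrite mul0r addr0.
  by rewrite -addn1 PoszD mulrDl mul1r addrA chiD.
by rewrite -[LHS]chiD -IHn -addn1 PoszD; congr (chi _); ring.
Qed.

Lemma Euler_int (a : nat) (m : int) : (0 < a)%N -> coprimez m a ->
  (a %| m ^+ totient a - 1)%Z.
Proof.
move=> a_gt0; rewrite /coprimez -gcdz_modl -eqz_mod_dvd -modzXm.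
have : (0 <= m %% a)%Z by rewrite modz_ge0 // -lt0n.
case: (m %% a)%Z => // r _ co_ra.
by rewrite -[Posz r]natz -natrX natz !modz_nat Euler_exp_totient.
Qed.

Lemma dirichlet_character_root (R : realType) (a : nat) (chi : int -> R[i]) (m : int) :
  (0 < a)%N -> dirichlet_character a chi -> coprimez m a -> chi m ^+ totient a = 1.
Proof.
move=> a_gt0 chiP co_ma; rewrite -(dirichlet_characterX _ _ chiP).
by rewrite (dirichlet_character_periodic chiP (Euler_int a_gt0 co_ma)) (dirichlet_character1 chiP).
Qed.

Lemma dirichlet_character_norm (R : realType) (a : nat) (chi : int -> R[i]) (m : int) :
  (0 < a)%N -> dirichlet_character a chi -> coprimez m a -> `|chi m| = 1.
Proof.
move=> a_gt0 chiP co_ma; apply/eqP; rewrite -(@pexpr_eq1 _ _ (totient a)) ?normr_ge0 ?totient_gt0 //.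
by rewrite -normrX (dirichlet_character_root a_gt0 chiP) ?normr1.
Qed.

Lemma principal_dirichlet_character (R : realType) (a : nat) :
  dirichlet_character a (principal_character R a).
Proof.
split=> [m n|m|m]; rewrite /principal_character.
- by rewrite coprimezMl -mulnb natrM.
- by rewrite /coprimez -gcdz_modl modzDr gcdz_modl.
- by rewrite pnatr_eq0 eqb0 negbK.
Qed.

Lemma dirichlet_character_mul (R : realType) (a : nat) (chi psi : int -> R[i]) :
  dirichlet_character a chi -> dirichlet_character a psi ->
  dirichlet_character a (fun m => chi m * psi m).
Proof.
case=> chiM chiD chi0 [psiM psiD psi0]; split=> [m n|m|m].
- by rewrite chiM psiM mulrACA.
- by rewrite chiD psiD.
- by rewrite mulf_eq0 negb_or chi0 psi0 andbb.
Qed.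

Lemma dirichlet_character_conj (R : realType) (a : nat) (chi : int -> R[i]) :
  dirichlet_character a chi -> dirichlet_character a (fun m => (chi m)^*%R).
Proof.
case=> chiM chiD chi0; split=> [m n|m|m].
- by rewrite chiM rmorphM.
- by rewrite chiD.
- by rewrite conjC_eq0 chi0.
Qed.

(* The irreducible characters of the unit group take their values in [algC];
   such an [f] carries these values to [R[i]]. *)
Lemma root_of_unity_transfer (E F : fieldType) (n : nat) (e : E) (w : F) :
  n.-primitive_root e -> n.-primitive_root w ->
  exists f : E -> F, forall x y, x ^+ n = 1 -> y ^+ n = 1 ->
    [/\ f (x * y) = f x * f y, f x != 0 & (f x == 1) = (x == 1)].
Proof.
move=> prim_e prim_w.
pose k x := oapp val 0%N [pick k : 'I_n | x == e ^+ k].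
have kP x : x ^+ n = 1 -> x = e ^+ k x.
  move=> /(prim_rootP prim_e)[j Dx]; rewrite /k.
  by case: pickP => [i /eqP //|/(_ j)]; rewrite Dx eqxx.
exists (fun x => w ^+ k x) => x y xn yn; split.
- rewrite -exprD; apply/eqP; rewrite (eq_prim_root_expr prim_w) -(eq_prim_root_expr prim_e).
  by rewrite -kP ?exprMn ?xn ?yn ?mulr1 // exprD -!kP.
- apply: expf_neq0; apply/eqP => w0; have /eqP := prim_expr_order prim_w.
  by rewrite w0 expr0n gtn_eqF ?(prim_order_gt0 prim_w) // eq_sym oner_eq0.
by rewrite -[1](expr0 w) (eq_prim_root_expr prim_w) -(eq_prim_root_expr prim_e) -kP.
Qed.

(** The type ['Z_a] always has at least two elements, so it is the ring of residues modulo [a] only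
    for [1 < a]. *)
Lemma intr_Zp_eq0 (a : nat) (z : int) : (1 < a)%N -> ((z%:~R : 'Z_a) == 0) = (a %| z)%Z.
Proof.
move=> a_gt1.
have a0 : (a%:Z%:~R : 'Z_a) = 0 by rewrite -pmulrn pchar_Zp.
have -> : (z%:~R : 'Z_a) = (z %% a)%Z%:~R.
  by rewrite {1}(divz_eq z a) intrD intrM a0 mulr0 add0r.
have a_neq0 : a%:Z != 0 by case: a a_gt1 {a0}.
have -> : (a %| z)%Z = ((z %% a)%Z == 0) by apply/dvdz_mod0P/eqP.
have := modz_ge0 z a_neq0; have := ltz_pmod z (_ : 0 < a%:Z).
case: (z %% a)%Z => // r /(_ (ltnW a_gt1)); rewrite ltz_nat => lt_ra _.
by rewrite -pmulrn -val_eqE /= val_Zp_nat // modn_small.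
Qed.

Lemma intr_Zp_unit (a : nat) (z : int) : (1 < a)%N ->
  ((z%:~R : 'Z_a) \is a GRing.unit) = coprimez z a.
Proof.
move=> a_gt1; rewrite /coprimez -gcdz_modl.
have a0 : (a%:Z%:~R : 'Z_a) = 0 by rewrite -pmulrn pchar_Zp.
have -> : (z%:~R : 'Z_a) = (z %% a)%Z%:~R.
  by rewrite {1}(divz_eq z a) intrD intrM a0 mulr0 add0r.
have a_neq0 : a%:Z != 0 by case: a a_gt1 {a0}.
have := modz_ge0 z a_neq0; case: (z %% a)%Z => // r _.
by rewrite -pmulrn unitZpE // coprime_sym.
Qed.

(** The unit group of ['Z_a] is abelian, so its irreducible characters are linear, and their kernels
    meet trivially. One of them is nontrivial at [m]; its values, roots of unity of order dividing
    the order of the group, are carried over to [R[i]]. *)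
Lemma dirichlet_character_separates (R : realType) (a : nat) (m : int) :
  (0 < a)%N -> coprimez m a -> ~~ (a %| m - 1)%Z ->
  exists2 chi : int -> R[i], dirichlet_character a chi & chi m != 1.
Proof.
move=> a_gt0 co_m ndvd.
have a_gt1 : (1 < a)%N by case: a a_gt0 ndvd {co_m} => [|[|a]] //; rewrite dvd1z.
(* The default value 1 at nonunits is harmless, as the character built below is 0 there. *)
pose U z : {unit 'Z_a} := insubd (1%g : {unit 'Z_a}) (z%:~R : 'Z_a).
have valU z : coprimez z a -> val (U z) = z%:~R.
  by move=> co_z; rewrite insubdK // -topredE /= intr_Zp_unit.
have UM y z : coprimez y a -> coprimez z a -> U (y * z) = (U y * U z)%g.
  move=> co_y co_z; apply: val_inj; rewrite valU ?coprimezMl ?co_y // FinRing.val_unitM.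
  by rewrite !valU // intrM.
have Um_neq1 : U m != 1%g.
  apply: contra ndvd => /eqP Um1; rewrite -intr_Zp_eq0 // intrD -valU // Um1.
  by rewrite subrr.
pose G := [set: {unit 'Z_a}]%G.
have abG : abelian G by exact: units_Zp_abelian.
have [i chi_m] : exists i, 'chi[G]_i (U m) != 1.
  apply/existsP; apply: contraR Um_neq1 => /existsPn all1.
  apply/eqP/set1gP; rewrite -(TI_cfker_irr G); apply/bigcapP => i _; rewrite cfkerEirr inE.
  have lin_i : 'chi_i \is a linear_char by exact/char_abelianP.
  by rewrite lin_char1 //; have := all1 i; rewrite negbK.
have lin_i : 'chi_i \is a linear_char by exact/char_abelianP.
have root_i z : 'chi_i (U z) ^+ #|G| = 1.
  have /dvdnP[q ->] : (#[U z]%g %| #|G|)%N by rewrite order_dvdG // finset.in_setT.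
  by rewrite mulnC exprM lin_char_unity_root ?finset.in_setT // expr1n.
have G_gt0 : (0 < #|G|)%N by exact: cardG_gt0.
have [e prim_e] := C_prim_root_exists G_gt0.
have [|w prim_w] := @closed_field_prim_root_exists R[i] _ G_gt0.
  by rewrite pnatr_eq0 -lt0n.
have [f fP] := root_of_unity_transfer prim_e prim_w.
exists (fun z => if coprimez z a then f ('chi_i (U z)) else 0); last first.
  by rewrite co_m; have [_ _ ->] := fP _ _ (root_i m) (root_i m).
split=> [y z|z|z].
- rewrite coprimezMl; case: (boolP (coprimez y a)) => co_y; last by rewrite mul0r.
  case: (boolP (coprimez z a)) => co_z; last by rewrite mulr0.
  rewrite /= UM // lin_charM ?finset.in_setT //.
  by have [-> _ _] := fP _ _ (root_i y) (root_i z).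
- have -> : U (z + a) = U z by rewrite /U intrD -[X in _ + X]pmulrn pchar_Zp // addr0.
  by rewrite {1}/coprimez -gcdz_modl modzDr gcdz_modl.
case: ifP => _; last by rewrite eqxx.
by have [_ -> _] := fP _ _ (root_i z) (root_i z).
Qed.

(** A character is determined by the exponents of its values on residues prime to [a], these values
    being powers of a fixed primitive root of unity of order [totient a]. *)
Lemma finite_dirichlet_characters (R : realType) (a : nat) : (0 < a)%N ->
  finite_set [set chi : int -> R[i] | dirichlet_character a chi]%classic.
Proof.
move=> a_gt0; have n_gt0 : (0 < totient a)%N by rewrite totient_gt0.
have [|w prim_w] := @closed_field_prim_root_exists R[i] _ n_gt0.
  by rewrite pnatr_eq0 -lt0n.
pose res (z : int) := Ordinal (ltn_pmod `|(z %% a)%Z|%N a_gt0).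
pose psi (F : {ffun 'I_a -> 'I_(totient a)}) (z : int) : R[i] :=
  if coprimez z a then w ^+ F (res z) else 0.
apply: (@sub_finite_set _ _ (psi @` setT)%classic); last exact/finite_image/finite_finset.
move=> chi /= chiP; exists [ffun r : 'I_a =>
  odflt (Ordinal n_gt0) [pick k : 'I_(totient a) | chi r == w ^+ k]] => //.
apply/funext => z; rewrite /psi; have [_ _ /(_ z) chi_z] := chiP.
case: ifP => co_z; last by move: chi_z; rewrite co_z => /negbFE/eqP ->.
have chi_res : chi z = chi (res z : nat).
  apply: (dirichlet_character_periodic chiP); rewrite -eqz_mod_dvd /=.
  have : (0 <= z %% a)%Z by rewrite modz_ge0 // -lt0n.
  by case Dz : (z %% a)%Z => [r|//] _; rewrite -modz_nat modz_mod -Dz modz_mod.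
rewrite ffunE chi_res.
have [j Dj] := prim_rootP prim_w (dirichlet_character_root a_gt0 chiP co_z).
by case: pickP => [k /eqP -> //|/(_ j)]; rewrite -chi_res Dj eqxx.
Qed.

(** * Orthogonality relations *)

Definition dirichlet_characters (R : realType) (a : nat) : {fset int -> R[i]} :=
  fset_set [set chi : int -> R[i] | dirichlet_character a chi]%classic.
Arguments dirichlet_characters : clear implicits.

Lemma mem_dirichlet_characters (R : realType) (a : nat) (chi : int -> R[i]) : (0 < a)%N ->
  reflect (dirichlet_character a chi) (chi \in dirichlet_characters R a).
Proof.
move=> a_gt0; rewrite in_fset_set; last exact: finite_dirichlet_characters.
by apply: (iffP idP) => [/set_mem|/mem_set].
Qed.

(** Multiplication by a character [psi] with [psi m != 1] permutes the characters, so the sum equals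
    [psi m] times itself. *)
Lemma sum_dirichlet_characters_eq0 (R : realType) (a : nat) (m : int) :
  (0 < a)%N -> coprimez m a -> ~~ (a %| m - 1)%Z ->
  \sum_(chi <- dirichlet_characters R a) chi m = 0.
Proof.
move=> a_gt0 co_m ndvd.
have [psi psiP psi_m] := dirichlet_character_separates R a_gt0 co_m ndvd.
pose h (chi : int -> R[i]) := fun z => psi z * chi z.
set X := dirichlet_characters R a.
have inj_h : {in X &, injective h}.
  move=> chi1 chi2 /(mem_dirichlet_characters _ a_gt0) [_ _ chi1z].
  move=> /(mem_dirichlet_characters _ a_gt0)[_ _ chi2z] eq_h; apply/funext => z.
  have [_ _ psiz] := psiP.
  have := congr1 (fun f => f z) eq_h; rewrite /h.
  case: (boolP (coprimez z a)) => co_z.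
    by apply: mulfI; rewrite psiz.
  by move: (chi1z z) (chi2z z); rewrite (negPf co_z) => /negbFE/eqP -> /negbFE/eqP ->.
have perm_h : perm_eq [seq h chi | chi <- X] X.
  have uniq_h : uniq [seq h chi | chi <- X] by rewrite map_inj_in_uniq ?fset_uniq.
  apply: uniq_perm; rewrite ?fset_uniq //.
  have sub_h : {subset [seq h chi | chi <- X] <= X}.
    move=> _ /mapP[chi /(mem_dirichlet_characters _ a_gt0) chiP ->].
    by apply/mem_dirichlet_characters => //; apply: dirichlet_character_mul.
  by have [|_ //] := uniq_min_size uniq_h sub_h; rewrite size_map.
apply/eqP; move: psi_m; apply: contraR => S_neq0.
rewrite -subr_eq0 -(mulIr_eq0 _ (mulIf S_neq0)) mulrBl mul1r subr_eq0; apply/eqP.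
rewrite -[in RHS](perm_big _ perm_h) big_map big_distrr.
by apply: eq_bigr.
Qed.

(** Dual argument: multiplication by an [m] prime to [a] with [chi m != 1] permutes the residues. *)
Lemma sum_residues_eq0 (R : realType) (a : nat) (chi : int -> R[i]) :
  (0 < a)%N -> dirichlet_character a chi -> chi <> principal_character R a ->
  \sum_(r < a) chi r = 0.
Proof.
move=> a_gt0 chiP chi_neq.
have [m co_m chi_m] : exists2 m, coprimez m a & chi m != 1.
  apply: contrapT => no_m; apply: chi_neq; apply/funext => m.
  rewrite /principal_character; case: (boolP (coprimez m a)) => co_m.
    apply/eqP; case: (boolP (chi m == 1)) => // chi_m.
    by case: no_m; exists m.
  by have [_ _ /(_ m)] := chiP; rewrite (negPf co_m) => /negbFE/eqP.
pose h (r : 'I_a) : 'I_a := Ordinal (ltn_pmod `|(m * r %% a)%Z|%N a_gt0).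
have hE (r : 'I_a) : (h r)%:Z = (m * r %% a)%Z.
  have : (0 <= m * r %% a)%Z by rewrite modz_ge0 // -lt0n.
  have := ltz_pmod (m * r) (_ : 0 < a%:Z); move/(_ a_gt0); rewrite /=.
  by case Dz : (m * r %% a)%Z => [q|//] lt_q _; rewrite modn_small.
have inj_h : injective h.
  move=> r s /(congr1 (fun x : 'I_a => x%:Z)); rewrite !hE => /eqP.
  rewrite eqz_mod_dvd -mulrBr Gauss_dvdzr; last by rewrite coprimez_sym.
  rewrite -eqz_mod_dvd !modz_nat !modn_small // => /eqP [eq_rs].
  exact: val_inj.
apply/eqP; move: chi_m; apply: contraR => S_neq0.
rewrite -subr_eq0 -(mulIr_eq0 _ (mulIf S_neq0)) mulrBl mul1r subr_eq0; apply/eqP.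
rewrite [RHS](reindex_inj inj_h) big_distrr; apply: eq_bigr => r _ /=.
have [chiM _ _] := chiP; rewrite -chiM; apply: (dirichlet_character_periodic chiP).
by rewrite hE -eqz_mod_dvd modz_mod.
Qed.

(** The sum of [chi r] over all residues and characters is computed in both orders: only the residue
    of 1 contributes in one, only the principal character in the other. *)
Lemma size_dirichlet_characters (R : realType) (a : nat) : (0 < a)%N ->
  (size (dirichlet_characters R a))%:R = (totient a)%:R :> R[i].
Proof.
move=> a_gt0; set X := dirichlet_characters R a.
transitivity (\sum_(r < a) \sum_(chi <- X) chi r); last first.
  rewrite exchange_big /=.
  have X0 : principal_character R a \in X.
    by apply/mem_dirichlet_characters => //; apply: principal_dirichlet_character.
  rewrite (bigD1_seq _ X0) ?fset_uniq //=.
  rewrite [X in _ + X]big1_seq ?addr0 => [|chi]; last first.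
    move=> /andP[/eqP chi_neq /(mem_dirichlet_characters _ a_gt0) chiP].
    exact: sum_residues_eq0.
  rewrite totient_count_coprime big_mkord natr_sum; apply: eq_bigr => r _.
  by rewrite /principal_character coprimezE /= coprime_sym.
(* The reduction matters for [a = 1], where the residue of 1 is 0. *)
pose one : 'I_a := Ordinal (ltn_pmod 1 a_gt0).
rewrite (bigD1 one) //= [X in _ + X]big1 ?addr0.
  rewrite (eq_big_seq (fun=> 1)); first by rewrite big_const_seq count_predT iter_addr_0.
  move=> chi /(mem_dirichlet_characters _ a_gt0) chiP.
  rewrite -(dirichlet_character1 chiP); apply: (dirichlet_character_periodic chiP).
  by rewrite -eqz_mod_dvd -modz_nat modz_mod.
move=> r r_neq; case: (boolP (coprimez r a)) => co_r.
  apply: sum_dirichlet_characters_eq0 => //; apply: contra r_neq.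
  by rewrite -eqz_mod_dvd !modz_nat modn_small.
rewrite big1_seq // => chi /andP[_ /(mem_dirichlet_characters _ a_gt0) chiP].
by have [_ _ /(_ r)] := chiP; rewrite (negPf co_r) => /negbFE/eqP.
Qed.

Lemma dirichlet_orthogonality (R : realType) (a : nat) (m : int) :
  (0 < a)%N -> coprimez m a ->
  \sum_(chi <- dirichlet_characters R a) chi m = (totient a * (a %| m - 1)%Z)%:R.
Proof.
move=> a_gt0 co_m; case: (boolP (a %| m - 1)%Z) => dvd; last first.
  by rewrite muln0 sum_dirichlet_characters_eq0.
rewrite muln1 -size_dirichlet_characters //.
rewrite (eq_big_seq (fun=> 1)); first by rewrite big_const_seq count_predT iter_addr_0.
move=> chi /(mem_dirichlet_characters _ a_gt0) chiP.
by rewrite (dirichlet_character_periodic chiP dvd) (dirichlet_character1 chiP).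
Qed.

(** The conjugate of [chi m] is its inverse, hence [chi t] for an inverse [t] of [m] modulo [a],
    which Euler's theorem gives as a power of [m]. *)
Lemma dirichlet_orthogonality_conj (R : realType) (a : nat) (m k : int) :
  (0 < a)%N -> coprimez m a -> coprimez k a ->
  \sum_(chi <- dirichlet_characters R a) (chi m)^*%R * chi k =
  (totient a * (a %| k - m)%Z)%:R.
Proof.
move=> a_gt0 co_m co_k; pose t := m ^+ (totient a).-1.
have mt : (a %| t * m - 1)%Z.
  by rewrite -exprSr prednK ?totient_gt0 // Euler_int.
have co_t : coprimez t a by rewrite coprimezXl.
rewrite (eq_big_seq (fun chi : int -> R[i] => chi (t * k))); last first.
  move=> chi /(mem_dirichlet_characters _ a_gt0) chiP; have [chiM _ _] := chiP.
  rewrite chiM; congr (_ * _).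
  have chi_m : chi m != 0 by have [_ _ ->] := chiP.
  apply: (mulIf chi_m); rewrite -chiM (dirichlet_character_periodic chiP mt).
  rewrite (dirichlet_character1 chiP) mulrC -normCK.
  by rewrite (dirichlet_character_norm a_gt0 chiP co_m) expr1n.
rewrite dirichlet_orthogonality ?coprimezMl ?co_t //; congr (_ * _)%:R; congr nat_of_bool.
rewrite -[RHS](@Gauss_dvdzr _ t) 1?coprimez_sym //.
have -> : t * k - 1 = t * (k - m) + (t * m - 1) by ring.
by rewrite rpredDr.
Qed.

(** * Pointwise bound for the twisted divisor sum *)

(** Induction on [k]: the divisors of [p ^ k.+1 * m] are those of [m] together with [p] times those
    of [p ^ k * m]. *)
Lemma sum_divisors_prime_power (R : pzSemiRingType) (g : nat -> R) (p k m : nat) :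
  prime p -> (0 < m)%N -> ~~ (p %| m)%N -> completely_multiplicative g ->
  \sum_(d <- divisors (p ^ k * m)) g d =
  (\sum_(j < k.+1) g p ^+ j) * \sum_(d <- divisors m) g d.
Proof.
move=> p_pr m_gt0 ndvd [g1 gM]; have p_gt0 := prime_gt0 p_pr.
elim: k => [|k IHk]; first by rewrite big_ord1 expr0 mul1r mul1n.
have n_gt0 : (0 < p ^ k.+1 * m)%N by rewrite muln_gt0 expn_gt0 p_gt0.
rewrite (bigID (dvdn p)) big_divisors_mul //=; last by rewrite expnS -mulnA dvdn_mulr.
rewrite expnS -mulnA mulKn // big_ord_recl expr0 mulrDl mul1r addrC; congr (_ + _).
  rewrite -big_filter; apply: perm_big; apply: uniq_perm.
  - by rewrite filter_uniq ?divisors_uniq.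
  - exact: divisors_uniq.
  move=> d; rewrite mem_filter mulnA -expnS -!dvdn_divisors //; apply/andP/idP.
    case=> ndvd_d; rewrite Gauss_dvdr // coprime_sym coprimeXl //.
    by rewrite prime_coprime.
  move=> dvd; split; last exact: dvdn_mull.
  by apply: contra ndvd => /dvdn_trans; apply.
under eq_bigr => d _ do rewrite gM.
rewrite -big_distrr /= IHk mulrA; congr (_ * _).
by rewrite big_distrr; apply: eq_bigr => j _; rewrite /= /bump -exprS.
Qed.

(** * Elementary inequalities behind the local bounds *)

Lemma exp4_le_exp2 (k : nat) : (k.+1 ^ 4 <= 8 ^ 2 * 2 ^ k)%N.
Proof.
case: (leqP k 4); first by move: k => [|[|[|[|[|]]]]].
(* The step [k.+2 ^ 4 <= 2 * k.+1 ^ 4] holds only from [k = 5] on, so the passage from 4 to 5 is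
   computed. *)
elim: k => // k IHk; rewrite ltnS leq_eqVlt => /orP[/eqP <- //|lt4k].
rewrite [(2 ^ _)%N]expnS mulnCA; apply: leq_trans (_ : 2 * k.+1 ^ 4 <= _)%N; last first.
  by rewrite leq_mul2l IHk.
clear IHk; have /subnK <- := lt4k; move: (k - 5)%N => i.
by rewrite !expnS expn0; nia.
Qed.

(** For the primes below 625, where [8 ^ 6] is the square of [prime_cost]; it arises from
    [4 * k + 7 <= 8 * k.+1]. *)
Lemma exp4_le_exp (p k : nat) : (2 <= p)%N -> ((4 * k + 7) ^ 4 <= 8 ^ 6 * p ^ k)%N.
Proof.
move=> p_ge2; apply: leq_trans (_ : (8 * k.+1) ^ 4 <= _)%N.
  by rewrite leq_exp2r //; lia.
rewrite expnMn (expnD 8 4 2) -mulnA leq_mul2l; apply/orP; right.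
apply: leq_trans (exp4_le_exp2 k) _; rewrite leq_mul2l; apply/orP; right.
by case: k => // k; rewrite leq_exp2r.
Qed.

Lemma lt_exp5 (k : nat) : (4 * k + 1 <= 5 ^ k)%N.
Proof. by elim: k => // k IHk; rewrite expnS; lia. Qed.

Lemma exp4_le_exp_even (p k : nat) : (625 <= p)%N -> ((4 * k + 1) ^ 4 <= p ^ k)%N.
Proof.
move=> le_p; apply: leq_trans (_ : (5 ^ k) ^ 4 <= _)%N.
  by rewrite leq_exp2r // lt_exp5.
by rewrite -expnM mulnC expnM; case: k => // k; rewrite leq_exp2r.
Qed.

Lemma exp4_le_exp_odd (p k : nat) : (625 <= p)%N -> ((4 * k + 7) ^ 4 <= p ^ k * p ^ 2)%N.
Proof.
move=> le_p; apply: leq_trans (_ : (5 ^ (k + 2)) ^ 4 <= _)%N.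
  by rewrite leq_exp2r // expnD; have := lt_exp5 k; lia.
by rewrite -expnD -expnM mulnC expnM leq_exp2r // addn2.
Qed.

Lemma sqr_le_sqrt (R : realType) (x y K : R) : 0 <= y -> 0 <= K ->
  x ^+ 4 <= K ^+ 2 * y -> x ^+ 2 <= K * Num.sqrt y.
Proof.
move=> y_ge0 K_ge0 le_xy; rewrite -(@ler_pXn2r _ 2) ?nnegrE ?sqr_ge0 ?mulr_ge0 ?sqrtr_ge0 //.
by rewrite -exprM exprMn sqr_sqrtr.
Qed.

(* Compares [|1 + ... + z ^ (2 e)| ^ 2 <= (2 e + 1) ^ 2] with [p ^ (e / 4)] for
   [2 <= e]: the former is at most the latter once [5 ^ 4 <= p]. *)
Definition prime_cost (R : realType) (p : nat) : R := if (p < 625)%N then 8 ^+ 3 else 1.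
Arguments prime_cost : clear implicits.

Lemma prime_cost_ge0 (R : realType) (p : nat) : 0 <= prime_cost R p.
Proof. by rewrite /prime_cost; case: ifP. Qed.

(** The case of exponent [e = 2 * k], where [2 * e + 1 = 4 * k + 1] and [p ^ k] goes into [b]. *)
Lemma prime_cost_even (R : realType) (p k : nat) : (2 <= p)%N ->
  (4 * k + 1)%:R ^+ 2 <= prime_cost R p * Num.sqrt (p ^ k)%:R.
Proof.
move=> p_ge2; apply: sqr_le_sqrt; rewrite ?prime_cost_ge0 // /prime_cost.
case: ltnP => [_|le_p].
  rewrite -exprM -!natrX -natrM ler_nat (leq_trans _ (exp4_le_exp k p_ge2)) //.
  by rewrite leq_exp2r // leq_add2l.
by rewrite expr1n mul1r -natrX ler_nat exp4_le_exp_even.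
Qed.

(** The case of exponent [e = 2 * k + 3], where [2 * e + 1 = 4 * k + 7], [p ^ k] goes into [b] and
    [p] into [c]. *)
Lemma prime_cost_odd (R : realType) (p k : nat) : (2 <= p)%N ->
  (4 * k + 7)%:R ^+ 2 <= prime_cost R p * (Num.sqrt (p ^ k)%:R * p%:R).
Proof.
move=> p_ge2; rewrite mulrA mulrAC; apply: sqr_le_sqrt; rewrite ?mulr_ge0 ?prime_cost_ge0 //.
rewrite exprMn -mulrA -!natrX -natrM /prime_cost; case: ltnP => [_|le_p].
  rewrite -exprM -natrX -natrM ler_nat (leq_trans (exp4_le_exp k p_ge2)) //.
  rewrite leq_mul2l; apply/orP; right; by rewrite leq_pmull // expn_gt0 ltnW.
by rewrite expr1n mul1r ler_nat [(p ^ 2 * _)%N]mulnC exp4_le_exp_odd.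
Qed.

(* The nine terms of [|1 + z + z ^ 2| ^ 2] for [|z| = 1]. *)
Definition twist_factors (R : realType) (chi : int -> R[i]) : seq (nat -> R[i]) :=
  let X n := chi n%:Z in
  [:: fun=> 1; fun=> 1; fun=> 1; X; X; fun n => (X n)^*%R; fun n => (X n)^*%R;
      fun n => X n * X n; fun n => (X n)^*%R * (X n)^*%R].

Definition divisor_twist (R : realType) (chi : int -> R[i]) (n : nat) : R[i] :=
  \sum_(u <- divisors (n ^ 2)) chi u%:Z.

Lemma completely_multiplicative_character (R : realType) (a : nat) (chi : int -> R[i]) :
  dirichlet_character a chi -> completely_multiplicative (fun n : nat => chi n%:Z).
Proof.
move=> chiP; split=> [|m n]; first exact: dirichlet_character1 chiP.
by have [chiM _ _] := chiP; rewrite PoszM chiM.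
Qed.

Lemma completely_multiplicative_factors (R : realType) (a : nat) (chi : int -> R[i]) (i : nat) :
  dirichlet_character a chi -> (i < size (twist_factors chi))%N ->
  completely_multiplicative (nth (fun=> 0) (twist_factors chi) i).
Proof.
move=> chiP; have cm1 : completely_multiplicative (fun=> 1 : R[i]).
  by split=> // m n; rewrite mulr1.
have conjP := dirichlet_character_conj chiP.
have cmX := completely_multiplicative_character chiP.
have cmXc := completely_multiplicative_character conjP.
have cmX2 := completely_multiplicative_character (dirichlet_character_mul chiP chiP).
have cmX2c := completely_multiplicative_character (dirichlet_character_mul conjP conjP).
by move: i; do 9! [case=> [//|]].
Qed.

Lemma sum_twist_factors (R : realType) (a : nat) (chi : int -> R[i]) (m : nat) :
  (0 < a)%N -> dirichlet_character a chi ->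
  \sum_(g <- twist_factors chi) g m =
  if coprime m a then `|1 + chi m + chi m ^+ 2| ^+ 2 else 3%:R.
Proof.
move=> a_gt0 chiP; rewrite !big_cons big_nil /=.
case: ifP => co_m; last first.
  have -> : chi m = 0 by have [_ _ /(_ m%:Z)] := chiP; rewrite coprimezE /= co_m => /negbFE/eqP.
  by rewrite conjC0; ring.
have zz : chi m * (chi m)^*%R = 1.
  by rewrite -normCK (dirichlet_character_norm a_gt0 chiP) ?expr1n // coprimezE.
rewrite normCK !rmorphD rmorphXn rmorph1 /=; move: zz; set z := chi m; set w := _^*%R => zz.
(* Inserting factors [z * w = 1] turns the nine values into the expansion of
   [(1 + z + z ^+ 2) * (1 + w + w ^+ 2)]. *)
transitivity (1 + z * w + (z * w) ^+ 2 + z + w + z * (z * w) + w * (z * w) + z ^+ 2 + w ^+ 2).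
  by rewrite zz; ring.
by ring.
Qed.

Lemma twist_product_ge0 (R : realType) (a : nat) (chi : int -> R[i]) (n : nat) :
  (0 < a)%N -> dirichlet_character a chi -> 0 <= dirichlet_prod (twist_factors chi) n.
Proof.
move=> a_gt0 chiP; apply: dirichlet_prod_ge0 => [i lt_i|p _].
  exact: completely_multiplicative_factors chiP lt_i.
by rewrite (sum_twist_factors _ a_gt0 chiP); case: ifP => _; rewrite ?exprn_ge0 ?ler0n.
Qed.

Lemma divisor_twist_prime_power (R : realType) (a : nat) (chi : int -> R[i]) (p e m : nat) :
  dirichlet_character a chi -> prime p -> (0 < m)%N -> ~~ (p %| m)%N ->
  divisor_twist chi (p ^ e * m) = (\sum_(j < (2 * e).+1) chi p ^+ j) * divisor_twist chi m.
Proof.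
move=> chiP p_pr m_gt0 ndvd; rewrite /divisor_twist expnMn -expnM mulnC [(e * 2)%N]mulnC mulnC.
rewrite (sum_divisors_prime_power _ p_pr) ?expn_gt0 ?m_gt0 // ?Euclid_dvdX ?andbT //.
exact: completely_multiplicative_character chiP.
Qed.

Lemma modulus_character_le1 (R : realType) (a : nat) (chi : int -> R[i]) (m : int) :
  (0 < a)%N -> dirichlet_character a chi -> modulus (chi m) <= 1.
Proof.
move=> a_gt0 chiP; case: (boolP (coprimez m a)) => co_m.
  by rewrite /modulus (dirichlet_character_norm a_gt0 chiP co_m) lexx.
have -> : chi m = 0 by have [_ _ /(_ m)] := chiP; rewrite (negPf co_m) => /negbFE/eqP.
by rewrite modulus0 ler01.
Qed.

Lemma modulusX (R : realType) (z : R[i]) (n : nat) : modulus (z ^+ n) = modulus z ^+ n.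
Proof.
elim: n => [|n IHn]; first by rewrite !expr0 modulus1.
by rewrite !exprS modulusM IHn.
Qed.

Lemma modulus_geometric_le (R : realType) (z : R[i]) (n : nat) : modulus z <= 1 ->
  modulus (\sum_(j < n) z ^+ j) <= n%:R.
Proof.
move=> z_le1; apply: le_trans (ler_modulus_sum _ _ _) _.
rewrite -[leRHS]mulr_natl mulr1 -[n in leRHS]card_ord -sumr_const.
by apply: ler_sum => j _; rewrite modulusX exprn_ile1 ?modulus_ge0.
Qed.

Lemma prime_cost_ge1 (R : realType) (p : nat) : 1 <= prime_cost R p.
Proof. by rewrite /prime_cost; case: ifP => // _; rewrite exprn_ege1 // ler1n. Qed.

(** All factors are at least 1 and those from 625 on equal 1, so a finite product dominates all of
    them. *)
Lemma prod_prime_cost_bounded (R : realType) :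
  exists2 K : R, 0 <= K & forall M, \prod_(0 <= p < M) prime_cost R p <= K.
Proof.
have cost_gt (p k : nat) : (625 <= k)%N -> (k <= p)%N -> prime_cost R p = 1.
  by rewrite /prime_cost => le_k /(leq_trans le_k); rewrite leqNgt => /negPf ->.
have [k le_k] : exists k, (625 <= k)%N by exists 625%N.
have ge1 (m n : nat) : 1 <= \prod_(m <= p < n) prime_cost R p.
  elim/big_ind: _ => // [x y x_ge1 y_ge1|p _]; last exact: prime_cost_ge1.
  by rewrite (le_trans y_ge1) // ler_peMl // (le_trans ler01).
exists (\prod_(0 <= p < k) prime_cost R p); first exact: le_trans (ge1 _ _).
move=> M; case: (leqP M k) => [le_M|/ltnW le_M].
  by rewrite [leRHS](@big_cat_nat _ _ _ M) //= ler_peMr // (le_trans ler01).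
have tail1 : \prod_(k <= p < M) prime_cost R p = 1.
  by rewrite big_nat big1 // => p /andP[le_kp _]; apply: cost_gt le_k le_kp.
by rewrite (@big_cat_nat _ _ _ k) //= tail1 mulr1.
Qed.

Lemma twist_product_prime (R : realType) (a : nat) (chi : int -> R[i]) (p m : nat) :
  (0 < a)%N -> dirichlet_character a chi -> prime p -> (0 < m)%N -> ~~ (p %| m)%N ->
  coprime p a ->
  modulus (dirichlet_prod (twist_factors chi) (p * m)) =
  modulus (\sum_(j < 3) chi p ^+ j) ^+ 2 * modulus (dirichlet_prod (twist_factors chi) m).
Proof.
move=> a_gt0 chiP p_pr m_gt0 ndvd co_p; rewrite dirichlet_prod_prime //; last first.
  by move=> i; apply: completely_multiplicative_factors chiP.
rewrite modulusM (sum_twist_factors _ a_gt0 chiP) co_p; congr (_ * _).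
rewrite 3!big_ord_recr big_ord0 /= add0r expr0 expr1 -modulusX.
by rewrite /modulus !normrX normr_id.
Qed.

(** Induction on the bound [M] for the primes dividing [n], splitting off the full power of the
    largest admissible prime. Exponent 1 goes into [s] without loss; exponents from 2 on go into [b]
    and [c], and their local factor is paid for by [prime_cost]. *)
Lemma divisor_twist_bound (R : realType) (a : nat) (chi : int -> R[i]) (M n : nat) :
  (0 < a)%N -> dirichlet_character a chi -> (0 < n)%N -> coprime n a ->
  (forall p, prime p -> (p %| n)%N -> (p < M)%N) ->
  exists s b c : nat, n = (s * b ^ 2 * c ^ 3)%N /\
    modulus (divisor_twist chi n) ^+ 2 <=
    \prod_(0 <= p < M) prime_cost R p * (Num.sqrt b%:R * c%:R) *
    modulus (dirichlet_prod (twist_factors chi) s).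
Proof.
move=> a_gt0 chiP; elim: M n => [|M IHM] n n_gt0 co_n lt_n.
  have -> : n = 1%N.
    apply/eqP; rewrite eqn_leq n_gt0 andbT leqNgt; apply/negP => n_gt1.
    by have := lt_n _ (pdiv_prime n_gt1) (pdiv_dvd n).
  exists 1%N, 1%N, 1%N; split=> //.
  rewrite big_geq // sqrtr1 !mul1r dirichlet_prod1; last first.
    by move=> i; apply: completely_multiplicative_factors chiP.
  by rewrite /divisor_twist big_seq1 (dirichlet_character1 chiP) modulus1 expr1n.
have prod_ge0 : 0 <= \prod_(0 <= p < M) prime_cost R p.
  by apply: prodr_ge0 => p _; apply: prime_cost_ge0.
rewrite big_nat_recr //=.
case: (boolP (prime M && (M %| n)%N)) => [/andP[M_pr dvd_M]|ndvd_M]; last first.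
  have [|s [b [c [Dn le_n]]]] := IHM n n_gt0 co_n.
    move=> p p_pr dvd_p; have := lt_n p p_pr dvd_p; rewrite ltnS leq_eqVlt.
    by case: eqP => // Dp; rewrite -Dp p_pr dvd_p in ndvd_M.
  exists s, b, c; split=> //; apply: le_trans le_n _.
  rewrite ler_wpM2r ?modulus_ge0 // ler_wpM2r ?mulr_ge0 ?sqrtr_ge0 //.
  by rewrite ler_peMr // prime_cost_ge1.
have M_gt1 := prime_gt1 M_pr.
have [m co_m Dn] := pfactor_coprime M_pr n_gt0.
have e_gt0 : (0 < logn M n)%N by rewrite logn_gt0 mem_primes M_pr n_gt0.
set e := logn M n in Dn e_gt0.
have m_gt0 : (0 < m)%N by move: n_gt0; rewrite Dn muln_gt0 => /andP[].
have ndvd : ~~ (M %| m)%N by rewrite -prime_coprime.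
have co_ma : coprime m a by move: co_n; rewrite Dn coprimeMl => /andP[].
have co_Ma : coprime M a by apply: coprime_dvdl co_n.
have [|s [b [c [Dm le_m]]]] := IHM m m_gt0 co_ma.
  move=> p p_pr dvd_p; have : (p < M.+1)%N by apply: lt_n => //; rewrite Dn dvdn_mulr.
  rewrite ltnS leq_eqVlt => /orP[/eqP Dp|//].
  by rewrite -Dp dvd_p in ndvd.
have -> : modulus (divisor_twist chi n) ^+ 2 =
    modulus (\sum_(j < (2 * e).+1) chi M ^+ j) ^+ 2 * modulus (divisor_twist chi m) ^+ 2.
  by rewrite Dn mulnC (divisor_twist_prime_power _ chiP M_pr) // modulusM exprMn.
set P := \prod_(0 <= p < M) _ in prod_ge0 le_m *.
set A := modulus (dirichlet_prod _ s) in le_m.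
have A_ge0 : 0 <= A by apply: modulus_ge0.
(* For exponent at least 2 the part [s] is unchanged, so it suffices to compare the trivial bound
   [2 * e + 1] for the local sum with the growth of [sqrt b * c]. *)
have key (b' c' : nat) : n = (s * b' ^ 2 * c' ^ 3)%N ->
    (2 * e).+1%:R ^+ 2 * (Num.sqrt b%:R * c%:R) <= prime_cost R M * (Num.sqrt b'%:R * c'%:R) ->
    exists s b c : nat, n = (s * b ^ 2 * c ^ 3)%N /\
      modulus (\sum_(j < (2 * e).+1) chi M ^+ j) ^+ 2 * modulus (divisor_twist chi m) ^+ 2 <=
      P * prime_cost R M * (Num.sqrt b%:R * c%:R) *
      modulus (dirichlet_prod (twist_factors chi) s).
  move=> Dn' le'; exists s, b', c'; split=> //; rewrite -/A.
  apply: le_trans (_ : (2 * e).+1%:R ^+ 2 * (P * (Num.sqrt b%:R * c%:R) * A) <= _).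
    apply: ler_pM; rewrite ?exprn_ge0 ?modulus_ge0 //.
    apply: lerXn2r; rewrite ?nnegrE ?modulus_ge0 ?ler0n //.
    by apply: modulus_geometric_le; apply: modulus_character_le1 chiP.
  have -> : (2 * e).+1%:R ^+ 2 * (P * (Num.sqrt b%:R * c%:R) * A) =
      P * A * ((2 * e).+1%:R ^+ 2 * (Num.sqrt b%:R * c%:R)) by ring.
  have -> : P * prime_cost R M * (Num.sqrt b'%:R * c'%:R) * A =
      P * A * (prime_cost R M * (Num.sqrt b'%:R * c'%:R)) by ring.
  by rewrite ler_wpM2l // mulr_ge0.
case: (ltnP 1 e) => [e_gt1|]; last first.
  move=> e_le1; have e1 : e = 1%N by apply/eqP; rewrite eqn_leq e_le1.
  exists (M * s)%N, b, c; split; first by rewrite Dn Dm e1 expn1; lia.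
  rewrite e1 (twist_product_prime a_gt0 chiP M_pr) //; last first.
  - by apply: contra ndvd => dvd; rewrite Dm -mulnA dvdn_mulr.
  - by move: m_gt0; rewrite Dm !muln_gt0 -andbA => /andP[].
  rewrite muln1 [leRHS]mulrCA ler_wpM2l ?exprn_ge0 ?modulus_ge0 // -/A (le_trans le_m) //.
  rewrite ler_wpM2r // ler_wpM2r ?mulr_ge0 ?sqrtr_ge0 //.
  by rewrite ler_peMr // prime_cost_ge1.
have De := odd_double_half e; set k := e./2 in De.
case: (boolP (odd e)) De => odd_e; rewrite ?add0n ?add1n => De.
  have k_gt0 : (0 < k)%N by move: e_gt1; rewrite -De; case: (k).
  (* An odd exponent [2 * k + 1] with [0 < k] is written as [2 * k.-1 + 3]. *)
  apply: (key (M ^ k.-1 * b)%N (M * c)%N).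
    rewrite {1}Dn {1}Dm -De -(prednK k_gt0) -muln2.
    rewrite [in LHS](_ : ((k.-1).+1 * 2).+1 = k.-1 * 2 + 3)%N; last lia.
    by rewrite expnD expnM !expnMn; ring.
  have -> : (2 * e).+1 = (4 * k.-1 + 7)%N by rewrite -De; lia.
  rewrite !natrM sqrtrM //; set S := Num.sqrt b%:R; set K := Num.sqrt _.
  have -> : prime_cost R M * (K * S * (M%:R * c%:R)) =
    prime_cost R M * (K * M%:R) * (S * c%:R) by ring.
  by rewrite ler_wpM2r ?mulr_ge0 ?sqrtr_ge0 // prime_cost_odd.
apply: (key (M ^ k * b)%N c).
  by rewrite {1}Dn {1}Dm -De -muln2 expnM !expnMn; ring.
have -> : (2 * e).+1 = (4 * k + 1)%N by rewrite -De; lia.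
rewrite !natrM sqrtrM // -[in leRHS]mulrA [leRHS]mulrA.
by rewrite ler_wpM2r ?mulr_ge0 ?sqrtr_ge0 // prime_cost_even.
Qed.

(** * Counting Egyptian fractions *)

Lemma egyptian_eq_nat (n a x y : nat) : (0 < n)%N -> (0 < x)%N -> (0 < y)%N ->
  (a%:R / n%:R = x%:R^-1 + y%:R^-1 :> rat) <-> (a * x * y = n * (x + y))%N.
Proof.
move=> n_gt0 x_gt0 y_gt0.
have n0 : n%:R != 0 :> rat by rewrite pnatr_eq0 -lt0n.
have x0 : x%:R != 0 :> rat by rewrite pnatr_eq0 -lt0n.
have y0 : y%:R != 0 :> rat by rewrite pnatr_eq0 -lt0n.
have -> : x%:R^-1 + y%:R^-1 = (x%:R + y%:R) / (x%:R * y%:R) :> rat.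
  by field; rewrite x0 y0.
rewrite -natrD -natrM; split => [/eqP|eq_nat].
  rewrite eqr_div ?natrM ?mulf_neq0 // -!natrM eqr_nat => /eqP; nia.
by apply/eqP; rewrite eqr_div ?natrM ?mulf_neq0 // -!natrM eqr_nat; apply/eqP; nia.
Qed.

(** The bijection is [u = a * x - n], with complementary divisor [a * y - n]. *)
Lemma nb_egyptianE (n a : nat) : (0 < n)%N -> (0 < a)%N -> coprime n a ->
  nb_egyptian n a = count (fun u => a %| u + n)%N (divisors (n ^ 2)).
Proof.
move=> n_gt0 a_gt0 co_na; have n2_gt0 : (0 < n ^ 2)%N by rewrite expn_gt0 n_gt0.
pose s := [seq u <- divisors (n ^ 2) | (a %| u + n)%N].
pose f u := ((u + n) %/ a, (n ^ 2 %/ u + n) %/ a)%N.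
rewrite /nb_egyptian; have -> : egyptian_pairs n a = [set` [fset p in [seq f u | u <- s]]%fset]%classic.
  apply/seteqP; split=> -[x y] /=.
    case=> /= x_gt0 y_gt0 /egyptian_eq_nat eq_xy; have {eq_xy} eq_xy := eq_xy n_gt0 x_gt0 y_gt0.
    rewrite in_fset /=; apply/mapP.
    (* From [a * x * y = n * (x + y) > n * y]; hence the truncated subtractions below are exact. *)
    have ax_gt : (n < a * x)%N by nia.
    have ay_gt : (n < a * y)%N by nia.
    have ux : (a * x - n + n = a * x)%N by rewrite subnK // ltnW.
    have uv : ((a * y - n) * (a * x - n) = n ^ 2)%N by nia.
    have u_gt0 : (0 < a * x - n)%N by rewrite subn_gt0.
    exists (a * x - n)%N.
      by rewrite mem_filter -dvdn_divisors // ux dvdn_mulr // -uv dvdn_mull.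
    rewrite /f ux mulKn // -uv mulnK // subnK; last exact: ltnW.
    by rewrite mulKn.
  rewrite in_fset /= => /mapP[u]; rewrite mem_filter -dvdn_divisors // => /andP[dvd_a dvd_u].
  have u_gt0 := dvdn_gt0 n2_gt0 dvd_u.
  case=> -> ->; set v := (n ^ 2 %/ u)%N.
  have uv : (v * u = n ^ 2)%N by rewrite divnK.
  have co_au : coprime a u.
    by rewrite coprime_sym (coprime_dvdl dvd_u) // coprimeXl.
  have dvd_v : (a %| v + n)%N.
    (* Coprimality makes the congruence for [u] imply the one for the complementary divisor [v]. *)
    rewrite -(Gauss_dvdr _ co_au) (_ : u * (v + n) = n * (u + n))%N; last by nia.
    exact: dvdn_mull.
  have v_gt0 : (0 < v)%N by rewrite divn_gt0 // dvdn_leq.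
  have ax := divnK dvd_a; have ay := divnK dvd_v.
  have x_gt0 : (0 < (u + n) %/ a)%N by rewrite divn_gt0 // dvdn_leq // addn_gt0 u_gt0.
  have y_gt0 : (0 < (v + n) %/ a)%N by rewrite divn_gt0 // dvdn_leq // addn_gt0 v_gt0.
  split=> //=; apply/egyptian_eq_nat => //.
  by apply/eqP; rewrite -(eqn_pmul2l a_gt0); apply/eqP; nia.
rewrite set_fsetK card_fseq undup_id.
  by rewrite size_map size_filter.
rewrite map_inj_in_uniq ?filter_uniq ?divisors_uniq // => u w.
rewrite !mem_filter => /andP[dvd_u _] /andP[dvd_w _] [eq_uw _].
by have := divnK dvd_u; rewrite eq_uw divnK // => /addIn.
Qed.

(** * The second moment *)

Lemma sum_character_bounded (R : realType) (a : nat) (psi : int -> R[i]) :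
  (0 < a)%N -> dirichlet_character a psi -> psi <> principal_character R a ->
  exists M : R, forall x, modulus (summatory (fun n : nat => psi n) x) <= M.
Proof.
move=> a_gt0 psiP psi_neq.
have psiDM (n q : nat) : psi (n + q * a)%N = psi n.
  apply: (dirichlet_character_periodic psiP).
  by rewrite PoszD addrAC subrr add0r PoszM dvdz_mull.
have sum0 q : \sum_(0 <= n < q * a) psi n = 0.
  elim: q => [|q IHq]; first by rewrite mul0n big_geq.
  rewrite mulSn addnC (@big_cat_nat _ _ _ (q * a)) ?leq_addr //= IHq add0r.
  rewrite -{1}[(q * a)%N]add0n big_addn addKn.
  under eq_bigr => n _ do rewrite psiDM.
  by rewrite big_mkord (sum_residues_eq0 a_gt0).
(* Full periods cancel, the incomplete one has fewer than [a] terms, and 1 accounts for [psi 0],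
   added to start at a multiple of [a]. *)
exists (a%:R + 1) => x.
have -> : summatory (fun n : nat => psi n) x = \sum_(0 <= n < x.+1) psi n - psi 0.
  by rewrite [in RHS]big_ltn // addrAC subrr add0r.
rewrite (le_trans (ler_modulusD _ _)) // modulusN lerD //; last first.
  exact: modulus_character_le1 psiP.
rewrite (divn_eq x.+1 a) (@big_cat_nat _ _ _ (x.+1 %/ a * a)) ?leq_addr //= sum0 add0r.
rewrite (le_trans (ler_modulus_sum _ _ _)) //.
apply: le_trans (_ : \sum_(x.+1 %/ a * a <= n < x.+1 %/ a * a + x.+1 %% a) 1 <= _).
  by apply: ler_sum => n _; apply: modulus_character_le1 psiP.
by rewrite sumr_const_nat addKn ler_nat ltnW // ltn_pmod.
Qed.

Lemma ler_term_sum (R : numDomainType) (I : eqType) (r : seq I) (F : I -> R) (i : I) :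
  (forall j, 0 <= F j) -> i \in r -> F i <= \sum_(j <- r) F j.
Proof.
move=> F_ge0 r_i; rewrite (perm_big _ (perm_to_rem r_i)) big_cons lerDl.
by apply: sumr_ge0.
Qed.

(** The exponent is [2^-1 - 2 = - (1 + 2^-1)], so the loss of [sqrt b] is summable against the
    density of multiples of [b ^ 2]. *)
Lemma sum_sqrt_cube_le (R : realType) (x : nat) :
  \sum_(1 <= b < x.+1) Num.sqrt b%:R / (b ^ 2)%:R <= 3 :> R.
Proof.
have d_gt0 : 0 < 2^-1 :> R by rewrite invr_gt0.
have := sum_powR_cvg d_gt0 x; rewrite invrK (_ : 1 + 2 = 3); last by ring.
apply: le_trans; rewrite !big_nat; apply: ler_sum => b /andP[b_gt0 _].
have b0 : 0 < b%:R :> R by rewrite ltr0n.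
rewrite -powR12_sqrt ?(ltW b0) // natrX -powR_mulrn ?(ltW b0) // -powRB; last first.
  by apply/implyP => _; rewrite gt_eqF.
have -> : 2^-1 - 2%:R = - (1 + 2^-1) :> R by lra.
exact: lexx.
Qed.

Lemma sum_id_cube_le (R : realType) (x : nat) :
  \sum_(1 <= c < x.+1) c%:R / (c ^ 3)%:R <= 2 :> R.
Proof.
have := sum_powR_cvg (ltr01 : 0 < 1 :> R) x; rewrite invr1.
apply: le_trans; rewrite !big_nat; apply: ler_sum => c /andP[c_gt0 _].
have c0 : c%:R != 0 :> R by rewrite pnatr_eq0 -lt0n.
by rewrite (powR_invn 2) // natrX exprS invfM mulrA mulfV // mul1r.
Qed.

Lemma sum_twist_product (R : realType) (a : nat) (chi : int -> R[i]) :
  (0 < a)%N -> dirichlet_character a chi ->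
  (fun m => chi m ^+ 2) <> principal_character R a ->
  exists2 C : R, 0 <= C & forall x : nat,
    \sum_(1 <= m < x.+1) modulus (dirichlet_prod (twist_factors chi) m) <=
    C * x%:R * harmonic_sum R x ^+ 2.
Proof.
move=> a_gt0 chiP chi2_neq; have conjP := dirichlet_character_conj chiP.
have chi_neq : chi <> principal_character R a.
  move=> Dchi; apply: chi2_neq; apply/funext => m; rewrite Dchi /principal_character.
  by rewrite -natrX; case: coprimez.
have unconj (f g : int -> R[i]) : (fun m => (f m)^*%R) = g -> f = fun m => (g m)^*%R.
  by move=> <-; apply/funext => m; rewrite conjCK.
have conj_principal : (fun m => (principal_character R a m)^*%R) = principal_character R a.
  by apply/funext => m; rewrite /principal_character conjC_nat.
have conj_neq : (fun m => (chi m)^*%R) <> principal_character R a.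
  by move=> /(unconj _ _); rewrite conj_principal.
have sqr_neq : (fun m => chi m * chi m) <> principal_character R a by [].
have conj_sqr_neq : (fun m => (chi m)^*%R * (chi m)^*%R) <> principal_character R a.
  move=> eq_sqr; apply: chi2_neq; rewrite -conj_principal; apply: unconj.
  by rewrite -eq_sqr; apply/funext => m; rewrite rmorphXn.
(* What remains after the three constant factors are the six nonprincipal characters. *)
pose s := drop 3 (twist_factors chi).
have le1 i n : (i < size s)%N -> modulus (nth (fun=> 0) s i n) <= 1.
  have chi_le1 m := modulus_character_le1 m a_gt0 chiP.
  have conj_le1 m := modulus_character_le1 m a_gt0 conjP.
  have sqr_le1 m := modulus_character_le1 m a_gt0 (dirichlet_character_mul chiP chiP).
  have csqr_le1 m := modulus_character_le1 m a_gt0 (dirichlet_character_mul conjP conjP).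
  by case: i => [|[|[|[|[|[|//]]]]]] _ /=;
    first [exact: chi_le1 | exact: conj_le1 | exact: sqr_le1 | exact: csqr_le1].
have bdd i : (i < size s)%N -> exists M : R, forall x,
    modulus (summatory (nth (fun=> 0) s i) x) <= M.
  have chi_bdd := sum_character_bounded a_gt0 chiP chi_neq.
  have conj_bdd := sum_character_bounded a_gt0 conjP conj_neq.
  have sqr_bdd := sum_character_bounded a_gt0 (dirichlet_character_mul chiP chiP) sqr_neq.
  have csqr_bdd := sum_character_bounded a_gt0 (dirichlet_character_mul conjP conjP) conj_sqr_neq.
  by case: i => [|[|[|[|[|[|//]]]]]] _ /=.
have [al [C [al01 C_ge0 S_s]]] := summatory_dirichlet_prod (isT : (0 < size s)%N) le1 bdd.
have al_lt1 : al < 1 by case/andP: al01.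
exists (C * (2 / (1 - al))).
  by rewrite mulr_ge0 // divr_ge0 // subr_ge0 ltW.
move=> x; have := summatory_conv_one_powR al01 C_ge0 S_s.
set C1 := C * (2 / _) => S1.
have C1_ge0 : 0 <= C1 by rewrite mulr_ge0 // divr_ge0 // subr_ge0 ltW.
have S2 := @summatory_conv_one_harmonic R _ 0 C1 C1_ge0
  (fun x => eq_ind_r (fun t => _ <= t) (S1 x) (mulr1 (C1 * x%:R))).
have := summatory_conv_one_harmonic C1_ge0 S2 x.
(* Nonnegativity of the full product makes the modulus of the sum equal to the sum of the moduli. *)
congr (_ <= _); apply: complexI; rewrite modulusE ger0_norm.
  rewrite rmorph_sum /summatory; apply: eq_bigr => m _.
  rewrite -[RHS]/((modulus _)%:C) modulusE ger0_norm //.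
  exact: (twist_product_ge0 m a_gt0 chiP).
by apply: sumr_ge0 => m _; apply: (twist_product_ge0 m a_gt0 chiP).
Qed.

(** For [2 <= N] the constant 1 in the logarithmic bound is at most [ln N / ln 2]. *)
Lemma harmonic_sum_le_mul_ln (R : realType) (N : nat) : (2 <= N)%N ->
  harmonic_sum R N <= (1 + (ln 2)^-1) * ln N%:R.
Proof.
move=> N_ge2; have ln2_gt0 : 0 < ln 2 :> R by rewrite ln_gt0 // ltr1n.
have N_gt0 : (0 < N)%N by apply: leq_trans N_ge2.
have le_ln : ln 2 <= ln N%:R :> R by rewrite ler_ln ?posrE ?ltr0n // ler_nat.
rewrite (le_trans (harmonic_sum_le_ln _ N_gt0)) // mulrDl mul1r addrC lerD2l.
by rewrite mulrC ler_pdivlMr // mul1r.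
Qed.

Lemma divisor_twist_second_moment (R : realType) (a : nat) (chi : int -> R[i]) :
  (0 < a)%N -> dirichlet_character a chi ->
  (fun m => chi m ^+ 2) <> principal_character R a ->
  exists2 C : R, 0 <= C & forall N : nat, (2 <= N)%N ->
    \sum_(1 <= n < N.+1 | coprime n a) modulus (divisor_twist chi n) ^+ 2 <=
    C * (N%:R * ln N%:R ^+ 2).
Proof.
move=> a_gt0 chiP chi2_neq.
have [C1 C1_ge0 sum_A] := sum_twist_product a_gt0 chiP chi2_neq.
pose A m := modulus (dirichlet_prod (twist_factors chi) m).
have A_ge0 m : 0 <= A m by apply: modulus_ge0.
have [K K_ge0 le_K] := prod_prime_cost_bounded R.
pose L : R := 1 + (ln 2)^-1.
have L_ge0 : 0 <= L by rewrite addr_ge0 // invr_ge0 ln_ge0 // ler1n.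
exists (K * (C1 * L ^+ 2) * (3 * 2)); first by rewrite !mulr_ge0 ?exprn_ge0.
move=> N N_ge2.
(* The decomposition of [n] is one of the pairs [(b, c)] in range, so summing over all of them gives
   an upper bound in which [n] can be summed first. *)
pose G (b c n : nat) := if (b ^ 2 * c ^ 3 %| n)%N then
  K * (Num.sqrt b%:R * c%:R) * A (n %/ (b ^ 2 * c ^ 3))%N else 0.
have G_ge0 b c n : 0 <= G b c n.
  by rewrite /G; case: ifP => // _; rewrite !mulr_ge0 ?sqrtr_ge0.
apply: le_trans (_ : \sum_(1 <= n < N.+1) \sum_(1 <= b < N.+1) \sum_(1 <= c < N.+1) G b c n <= _).
  rewrite big_mkcond !big_nat; apply: ler_sum => n /andP[n_gt0 le_nN].
  have sum_ge0 : 0 <= \sum_(1 <= b < N.+1) \sum_(1 <= c < N.+1) G b c n.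
    by apply: sumr_ge0 => b _; apply: sumr_ge0 => c _; apply: G_ge0.
  case: ifP => // co_n.
  have [|s [b [c [Dn le_n]]]] := @divisor_twist_bound R a chi n.+1 n a_gt0 chiP n_gt0 co_n.
    by move=> p _ /dvdn_leq; rewrite ltnS; apply.
  have b_gt0 : (0 < b)%N by move: n_gt0; rewrite Dn; case: (b); rewrite ?muln0.
  have c_gt0 : (0 < c)%N by move: n_gt0; rewrite Dn; case: (c); rewrite ?muln0.
  have d_gt0 : (0 < b ^ 2 * c ^ 3)%N by rewrite muln_gt0 !expn_gt0 b_gt0 c_gt0.
  have Dn' : n = (s * (b ^ 2 * c ^ 3))%N by rewrite Dn mulnA.
  have le_dn : (b ^ 2 * c ^ 3 <= n)%N by rewrite dvdn_leq // Dn' dvdn_mull.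
  have b_in : b \in index_iota 1 N.+1.
    rewrite mem_index_iota b_gt0 (leq_ltn_trans _ le_nN) // (leq_trans _ le_dn) //.
    by rewrite (leq_trans (leq_pexp2l b_gt0 (ltn0Sn 1))) // leq_pmulr // expn_gt0 c_gt0.
  have c_in : c \in index_iota 1 N.+1.
    rewrite mem_index_iota c_gt0 (leq_ltn_trans _ le_nN) // (leq_trans _ le_dn) //.
    by rewrite (leq_trans (leq_pexp2l c_gt0 (ltn0Sn 2))) // leq_pmull // expn_gt0 b_gt0.
  apply: le_trans le_n _; apply: le_trans (_ : G b c n <= _).
    have dvd_dn : (b ^ 2 * c ^ 3 %| n)%N by rewrite Dn' dvdn_mull.
    have q_dn : (n %/ (b ^ 2 * c ^ 3) = s)%N by rewrite Dn' mulnK.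
    rewrite /G dvd_dn q_dn; apply: ler_wpM2r; first exact: A_ge0.
    by apply: ler_wpM2r (le_K n.+1); rewrite mulr_ge0 ?sqrtr_ge0.
  apply: le_trans (ler_term_sum (fun c => G_ge0 b c n) c_in) _.
  apply: (ler_term_sum (F := fun b => \sum_(1 <= c < N.+1) G b c n)) b_in => b'.
  by apply: sumr_ge0 => c' _; apply: G_ge0.
rewrite exchange_big /=.
under eq_bigr => b _ do rewrite exchange_big /=.
pose H := harmonic_sum R N.
have sum_G b c : (0 < b)%N -> (0 < c)%N -> \sum_(1 <= n < N.+1) G b c n <=
    K * (C1 * N%:R * H ^+ 2) * (Num.sqrt b%:R / (b ^ 2)%:R) * (c%:R / (c ^ 3)%:R).
  move=> b_gt0 c_gt0; have d_gt0 : (0 < b ^ 2 * c ^ 3)%N by rewrite muln_gt0 !expn_gt0 b_gt0 c_gt0.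
  rewrite -big_mkcond big_multiples //=.
  under eq_bigr => m _ do rewrite mulKn //.
  rewrite -big_distrr /=; set x := (N %/ _)%N.
  have -> : K * (C1 * N%:R * H ^+ 2) * (Num.sqrt b%:R / (b ^ 2)%:R) * (c%:R / (c ^ 3)%:R) =
      K * (Num.sqrt b%:R * c%:R) * (C1 * (N%:R / (b ^ 2 * c ^ 3)%:R) * H ^+ 2).
    by rewrite natrM; field; rewrite !pnatr_eq0 -!lt0n b_gt0 c_gt0.
  rewrite ler_wpM2l ?mulr_ge0 ?sqrtr_ge0 // (le_trans (sum_A x)) //.
  apply: ler_pM; rewrite ?mulr_ge0 ?exprn_ge0 ?harmonic_sum_ge0 //.
    by rewrite ler_wpM2l // ler_natr_div.
  by apply: lerXn2r; rewrite ?nnegrE ?harmonic_sum_ge0 // ler_harmonic_sum // leq_div.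
apply: le_trans (_ : \sum_(1 <= b < N.+1) \sum_(1 <= c < N.+1)
   K * (C1 * N%:R * H ^+ 2) * (Num.sqrt b%:R / (b ^ 2)%:R) * (c%:R / (c ^ 3)%:R) <= _).
  rewrite !big_nat; apply: ler_sum => b /andP[b_gt0 _].
  by rewrite !big_nat; apply: ler_sum => c /andP[c_gt0 _]; apply: sum_G.
under eq_bigr => b _ do rewrite -big_distrr /=.
rewrite -big_distrl -big_distrr /= -mulrA.
have H_le : H ^+ 2 <= (L * ln N%:R) ^+ 2.
  apply: lerXn2r; rewrite ?nnegrE ?harmonic_sum_ge0 ?harmonic_sum_le_mul_ln //.
  by rewrite mulr_ge0 // ln_ge0 // ler1n (leq_trans _ N_ge2).
have -> : K * (C1 * L ^+ 2) * (3 * 2) * (N%:R * ln N%:R ^+ 2) =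
  K * (C1 * N%:R * (L * ln N%:R) ^+ 2) * (3 * 2) by ring.
apply: ler_pM; rewrite ?mulr_ge0 ?(harmonic_sum_ge0 R N) //.
- by apply: sumr_ge0 => b _; rewrite divr_ge0 ?sqrtr_ge0.
- by apply: sumr_ge0 => c _; rewrite divr_ge0.
- by rewrite ler_wpM2l // ler_wpM2l // mulr_ge0.
apply: ler_pM; rewrite ?sum_sqrt_cube_le ?sum_id_cube_le //.
- by apply: sumr_ge0 => b _; rewrite divr_ge0 ?sqrtr_ge0.
by apply: sumr_ge0 => c _; rewrite divr_ge0.
Qed.

(** Iterates [(x + y) ^+ 2 <= 2 * x ^+ 2 + 2 * y ^+ 2]. It is applied to a list of characters modulo
    [a], so the exponential constant depends only on [a]. *)
Lemma sqr_sum_le (R : realType) (I : Type) (r : seq I) (F : I -> R) :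
  (\sum_(i <- r) F i) ^+ 2 <= 2 ^+ size r * \sum_(i <- r) F i ^+ 2.
Proof.
elim: r => [|i r IHr]; first by rewrite !big_nil expr0n mulr0.
rewrite !big_cons /= [2 ^+ (size r).+1]exprS; move: IHr; set S := \sum_(j <- r) F j.
set Q := \sum_(j <- r) _; set k := 2 ^+ size r => le_S.
have k_ge1 : 1 <= k by rewrite exprn_ege1 // ler1n.
have le2 : (F i + S) ^+ 2 <= 2 * F i ^+ 2 + 2 * S ^+ 2.
  by rewrite -subr_ge0 (_ : _ - _ = (F i - S) ^+ 2) ?sqr_ge0 //; ring.
apply: le_trans le2 _; rewrite -!mulrDr -mulrA ler_wpM2l // mulrDr lerD //.
by rewrite ler_peMl ?sqr_ge0.
Qed.

Lemma sum_dominated (R : realType) (I : eqType) (r : seq I) (F : I -> nat -> R) (g : nat -> R) :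
  (forall i, i \in r -> exists2 C : R, 0 <= C & forall N, (2 <= N)%N -> F i N <= C * g N) ->
  exists2 C : R, 0 <= C & forall N, (2 <= N)%N -> \sum_(i <- r) F i N <= C * g N.
Proof.
elim: r => [|i r IHr] dom.
  by exists 0 => // N _; rewrite big_nil mul0r.
have [C C_ge0 le_r] := IHr (fun j rj => dom j (mem_behead (s := i :: r) rj)).
have [D D_ge0 le_i] := dom i (mem_head i r).
exists (D + C) => [|N N_ge2]; first exact: addr_ge0.
by rewrite big_cons mulrDl lerD ?le_i ?le_r.
Qed.

(** Orthogonality detects the divisors [u] congruent to [- n] modulo [a]. *)
Lemma nb_egyptian_expansion (R : realType) (n a : nat) :
  (0 < n)%N -> (0 < a)%N -> coprime n a ->
  (nb_egyptian n a)%:R = (totient a)%:R^-1 *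
    \sum_(chi <- dirichlet_characters R a) (chi (- n%:Z))^*%R * divisor_twist chi n.
Proof.
move=> n_gt0 a_gt0 co_n; rewrite nb_egyptianE //.
under [X in _ * X]eq_bigr => chi _ do rewrite big_distrr /=.
rewrite exchange_big /= -sum1_count natr_sum big_mkcond big_distrr /=.
apply: eq_big_seq => u; rewrite -dvdn_divisors ?expn_gt0 ?n_gt0 // => dvd_u.
have co_u : coprimez u a by rewrite coprimezE /= (coprime_dvdl dvd_u) // coprimeXl.
have co_Nn : coprimez (- n%:Z) a by rewrite coprimezE abszN.
have -> := dirichlet_orthogonality_conj R a_gt0 co_Nn co_u.
have phi0 : (totient a)%:R != 0 :> R[i] by rewrite pnatr_eq0 -lt0n totient_gt0.
rewrite opprK -PoszD natrM mulrA mulVf // mul1r.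
by rewrite dvdzE /=; case: ifP.
Qed.

(** Puts the main term in the form of a subsum of the expansion of [nb_egyptian], so that it cancels
    there. *)
Lemma quadratic_main_term_expansion (R : realType) (n a : nat) : (0 < a)%N ->
  quadratic_main_term R n a = (totient a)%:R^-1 *
    \sum_(chi <- dirichlet_characters R a |
          `[< (fun m => chi m ^+ 2) = principal_character R a >])
      (chi (- n%:Z))^*%R * divisor_twist chi n.
Proof.
move=> a_gt0; rewrite /quadratic_main_term; congr (_ * _).
have fin_Q : finite_set (square_principal_characters R a).
  by apply: sub_finite_set (finite_dirichlet_characters R a_gt0) => chi [].
rewrite fsbig_finite // -[RHS]big_filter; apply: perm_big.
apply: uniq_perm; rewrite ?filter_uniq ?fset_uniq // => chi.
rewrite mem_filter in_fset_set //; apply/idP/andP.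
  move=> /set_mem[chiP chi2]; split; first exact/asboolP.
  exact/(mem_dirichlet_characters _ a_gt0).
move=> [/asboolP chi2 /(mem_dirichlet_characters _ a_gt0) chiP].
exact/mem_set.
Qed.

Theorem theorem1 (R : realType) (a : nat) (ha : (0 < a)%N) :
  exists2 C : R, 0 < C & forall N : nat, (2 <= N)%N ->
    \sum_(1 <= n < N.+1 | coprime n a)
       `| (nb_egyptian n a)%:R - quadratic_main_term R n a | ^+ 2
    <= (C * N%:R * ln N%:R ^+ 2)%:C.
Proof.
pose X := [seq chi <- dirichlet_characters R a |
  ~~ `[< (fun m => chi m ^+ 2) = principal_character R a >]].
have [|C C_ge0 le_C] := @sum_dominated R _ X
  (fun chi N => \sum_(1 <= n < N.+1 | coprime n a) modulus (divisor_twist chi n) ^+ 2)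
  (fun N => N%:R * ln N%:R ^+ 2).
  move=> chi; rewrite mem_filter => /andP[/asboolPn chi2 /(mem_dirichlet_characters _ ha) chiP].
  exact: divisor_twist_second_moment.
pose D : R := 2 ^+ size X; have D_ge0 : 0 <= D by rewrite exprn_ge0.
(* Adding 1 makes the constant positive even if [D * C] vanishes, as when no character is left in
   [X]. *)
exists (D * C + 1) => [|N N_ge2]; first by rewrite ltr_wpDl ?mulr_ge0.
have g_ge0 : 0 <= N%:R * ln N%:R ^+ 2 :> R by rewrite mulr_ge0 ?sqr_ge0.
apply: le_trans (_ : (D * \sum_(chi <- X) \sum_(1 <= n < N.+1 | coprime n a)
   modulus (divisor_twist chi n) ^+ 2)%:C <= _); last first.
  rewrite lecR -[leRHS]mulrA mulrDl mul1r -[leLHS]addr0 lerD //.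
  by rewrite -mulrA ler_wpM2l // le_C.
rewrite exchange_big big_distrr /= rmorph_sum big_nat_cond [leRHS]big_nat_cond /=.
apply: ler_sum => n /andP[/andP[n_gt0 _] co_n].
have -> : (nb_egyptian n a)%:R - quadratic_main_term R n a =
    (totient a)%:R^-1 * \sum_(chi <- X) (chi (- n%:Z))^*%R * divisor_twist chi n.
  rewrite nb_egyptian_expansion // quadratic_main_term_expansion // -mulrBr; congr (_ * _).
  rewrite (bigID (fun chi => `[< (fun m => chi m ^+ 2) = principal_character R a >])) /=.
  by rewrite addrAC subrr add0r big_filter.
rewrite -modulusE -rmorphXn lecR modulusM exprMn.
have phi_le1 : modulus (totient a)%:R^-1 <= 1 :> R.
  rewrite -lecR modulusE normfV normr_nat invf_le1 ?ltr0n ?ler1n ?totient_gt0 //.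
apply: le_trans (_ : 1 * (\sum_(chi <- X) modulus (divisor_twist chi n)) ^+ 2 <= _); last first.
  by rewrite mul1r sqr_sum_le.
apply: ler_pM; rewrite ?sqr_ge0 //; first by rewrite exprn_ile1 ?modulus_ge0.
apply: lerXn2r; rewrite ?nnegrE ?modulus_ge0 //.
  by apply: sumr_ge0 => chi _; apply: modulus_ge0.
apply: le_trans (ler_modulus_sum _ _ _) _.
rewrite big_seq [leRHS]big_seq; apply: ler_sum => chi; rewrite mem_filter.
case/andP=> _ /(mem_dirichlet_characters _ ha) chiP.
rewrite modulusM ler_piMl ?modulus_ge0 //.
exact: modulus_character_le1 (dirichlet_character_conj chiP).
Qed.
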